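(* Let $K$ be a field of characteristic zero, let $q\in K^*$ be not a root of $1$, let $U_qsl(2)$ be the quantum $sl(2)$ over $K$, $Q(U_qsl(2))$ its division ring of fractions, and $C$ the (quantum) Casimir element. (1) The quantum $U_qsl(2)$ and its division ring $Q(U_qsl(2))$ satisfy the commutative centralizer condition, and the centre $Z(Q(U_qsl(2)))=K(C)$. (2) The quantum $U_qsl(2)$, and any noncommutative subalgebra $A$ of the division ring $Q(U_qsl(2))$ with Gelfand-Kirillov dimension $\operatorname{GK}(A)<4$ and such that $A\cap K(C)\neq K$, admits the Dixmier partition and satisfies both the homogeneous centralizer condition and the commutative centralizer condition.
   Context: $K^*=K\setminus\{0\}$. With $h=q-q^{-1}$, $U_qsl(2)=K\langle X,Y,H,H^{-1}\mid XH=qHX,\ YH=q^{-1}HY,\ [X,Y]=h^{-1}(H^2-H^{-2})\rangle$ (with $HH^{-1}=H^{-1}H=1$), and the Casimir element is $C=YX-h^{-1}\Big(\frac{H^2}{q^2-1}-\frac{H^{-2}}{q^{-2}-1}\Big)$, which generates the centre: $Z(U_qsl(2))=K[C]$; $K(C)$ is its field of fractions. Let $\overline K$ be the algebraic closure of $K$. For a $K$-algebra $A$ with centre $Z(A)$, put $\overline A=\overline K\otimes_K A$ and identify $A$ with $1\otimes A$. For $a\in A$ let $\operatorname{ad} a: b\mapsto [a,b]=ab-ba$, and put $C(a)=\ker(\operatorname{ad} a)$ (the centralizer of $a$ in $A$); $N(a)=\bigcup_{i\ge0}\ker\big((\operatorname{ad} a)^{i+1}\big)\subseteq A$; $D(a)=A\cap\bigoplus_{\lambda\in\overline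 K}\{b\in\overline A:[a,b]=\lambda b\}$; $F(a)=\{b\in A:\dim_K K[\operatorname{ad} a]\,b<\infty\}$. Types of elements $a\in A\setminus Z(A)$: $a\in\Delta_1(A)$ (strongly nilpotent) if $N(a)=A$ and $D(a)=C(a)$; $a\in\Delta_2(A)$ (weakly nilpotent) if $C(a)\ne N(a)\ne A$ and $D(a)=C(a)$; $a\in\Delta_3(A)$ (strongly semi-simple) if $N(a)=C(a)$ and $D(a)=A$; $a\in\Delta_4(A)$ (weakly semi-simple) if $N(a)=C(a)$ and $C(a)\ne D(a)=F(a)\ne A$; $a\in\Delta_5(A)$ (generic) if $N(a)=D(a)=C(a)$. $A$ admits the Dixmier partition if $A\setminus Z(A)=\Delta_1(A)\cup\cdots\cup\Delta_5(A)$. A noncommutative algebra satisfies the commutative centralizer condition if the centralizer of each of its non-central elements is a commutative algebra. A noncommutative algebra $A$ that admits the Dixmier partition satisfies the homogeneous centralizer condition if, for each $a\in A\setminus Z(A)$, the elements of $C(a)\setminus Z(A)$ are of exactly one of the following kinds: (1) all strongly nilpotent; (2) all weakly nilpotent; (3) all generic except for a subset $K^*a'+Z(A)$ of strongly semi-simple elements, for some $a'\in\Delta_3(A)$; (4) all generic except for a subset $K^*a'+Z(A)$ of weakly semi-simple elements, for some $a'\in\Delta_4(A)$; (5) all generic. *)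

(* Defs.v *)
From HB Require Import structures.
From mathcomp Require Import all_boot all_order all_algebra.
From mathcomp Require Import boolp classical_sets reals ereal sequences exp.
(* The notations of monalg and of the analysis files have incompatible levels. *)
From mathcomp Require Import -(notations) monalg.

Set Implicit Arguments.
Unset Strict Implicit.
Unset Printing Implicit Defensive.

Import Order.TTheory GRing.Theory Num.Theory.

Local Open Scope ring_scope.
Local Open Scope quotient_scope.
Local Open Scope classical_set_scope.

(** * The quotient of an algebra by the two-sided ideal generated by [S] *)

Section IdealQuotient.
Variables (K : fieldType) (A : algType K) (S : set A).

Definition in_ideal (x : A) : Prop :=
  exists2 s : seq (A * A * A), (forall t, t \in s -> S t.1.2)
    & x = \sum_(t <- s) t.1.1 * t.1.2 * t.2.

Definition ideal_pred : {pred A} := fun x => `[< in_ideal x >].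

Lemma in_ideal0 : in_ideal 0.
Proof. by exists [::]; rewrite ?big_nil. Qed.

Lemma in_idealD x y : in_ideal x -> in_ideal y -> in_ideal (x + y).
Proof.
move=> [s Ss ->] [t St ->]; exists (s ++ t); last by rewrite big_cat.
by move=> u; rewrite mem_cat => /orP[/Ss|/St].
Qed.

Lemma in_idealM a b x : in_ideal x -> in_ideal (a * x * b).
Proof.
move=> [s Ss ->]; exists [seq (a * t.1.1, t.1.2, t.2 * b) | t <- s].
  by move=> u /mapP[t /Ss St ->].
by rewrite big_map mulr_sumr mulr_suml; apply: eq_bigr => t _; rewrite !mulrA.
Qed.

Lemma ideal_pred_zmod : zmod_closed ideal_pred.
Proof.
split=> [|x y /asboolP Ix /asboolP Iy]; apply/asboolP; first exact: in_ideal0.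
apply: in_idealD => //; have := in_idealM (-1) 1 Iy.
by rewrite mulN1r mulr1.
Qed.

HB.instance Definition _ := GRing.isZmodClosed.Build A ideal_pred ideal_pred_zmod.

Lemma ideal_predM a b x : x \in ideal_pred -> a * x * b \in ideal_pred.
Proof. by move=> /asboolP Ix; apply/asboolP/in_idealM. Qed.

Lemma ideal_predMl a x : x \in ideal_pred -> a * x \in ideal_pred.
Proof. by move=> /(ideal_predM a 1); rewrite mulr1. Qed.

Lemma ideal_predMr b x : x \in ideal_pred -> x * b \in ideal_pred.
Proof. by move=> /(ideal_predM 1 b); rewrite mul1r. Qed.

Definition ideal_quot := Quotient.quot ideal_pred.
HB.instance Definition _ := GRing.Zmodule.on ideal_quot.
HB.instance Definition _ := EqQuotient.on ideal_quot.

Definition ideal_proj (x : A) : ideal_quot := \pi_ideal_quot x.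

Lemma ideal_projP x y : (ideal_proj x == ideal_proj y) = (x - y \in ideal_pred).
Proof. by rewrite [RHS](Quotient.idealrBE ideal_pred). Qed.

Lemma ideal_proj_eq x y : x - y \in ideal_pred -> ideal_proj x = ideal_proj y.
Proof. by rewrite -ideal_projP => /eqP. Qed.

Lemma ideal_projK x : repr (ideal_proj x) - x \in ideal_pred.
Proof. by rewrite -ideal_projP /ideal_proj reprK. Qed.

Lemma ideal_projB x y : ideal_proj (x - y) = ideal_proj x - ideal_proj y.
Proof. exact: (raddfB (\pi_(Quotient.quot ideal_pred))). Qed.

Lemma ideal_projD x y : ideal_proj (x + y) = ideal_proj x + ideal_proj y.
Proof. exact: (raddfD (\pi_(Quotient.quot ideal_pred))). Qed.

Lemma ideal_reprK x : ideal_proj (repr x) = x.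
Proof. exact: reprK. Qed.

Definition ideal_quot_one : ideal_quot := ideal_proj 1.
Definition ideal_quot_mul (x y : ideal_quot) := ideal_proj (repr x * repr y).
Definition ideal_quot_scale (c : K) (x : ideal_quot) := ideal_proj (c *: repr x).

Lemma ideal_quot_mulE x y :
  ideal_quot_mul (ideal_proj x) (ideal_proj y) = ideal_proj (x * y).
Proof.
apply: ideal_proj_eq; set x' := repr _; set y' := repr _.
rewrite -[x' * y'](subrK (x * y')) -addrA -mulrBl -mulrBr.
by apply: rpredD; [apply: ideal_predMr|apply: ideal_predMl]; apply: ideal_projK.
Qed.

Lemma ideal_quot_scaleE c x :
  ideal_quot_scale c (ideal_proj x) = ideal_proj (c *: x).
Proof.
apply: ideal_proj_eq; rewrite -scalerBr -[X in c *: X]mul1r scalerAl.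
by apply: ideal_predMl; apply: ideal_projK.
Qed.

Lemma ideal_quot_mulA : associative ideal_quot_mul.
Proof.
move=> x y z; rewrite -[x]ideal_reprK; move: (repr x) => {}x; rewrite -[y]ideal_reprK; move: (repr y) => {}y.
rewrite -[z]ideal_reprK; move: (repr z) => {}z.
by rewrite !ideal_quot_mulE mulrA.
Qed.
Lemma ideal_quot_mul1 : left_id ideal_quot_one ideal_quot_mul.
Proof. by move=> x; rewrite -[x]ideal_reprK; move: (repr x) => {}x; rewrite ideal_quot_mulE mul1r. Qed.
Lemma ideal_quot_mulr1 : right_id ideal_quot_one ideal_quot_mul.
Proof. by move=> x; rewrite -[x]ideal_reprK; move: (repr x) => {}x; rewrite ideal_quot_mulE mulr1. Qed.
Lemma ideal_quot_mulDl : left_distributive ideal_quot_mul +%R.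
Proof.
move=> x y z; rewrite -[x]ideal_reprK; move: (repr x) => {}x; rewrite -[y]ideal_reprK; move: (repr y) => {}y.
rewrite -[z]ideal_reprK; move: (repr z) => {}z.
by rewrite -ideal_projD !ideal_quot_mulE mulrDl ideal_projD.
Qed.
Lemma ideal_quot_mulDr : right_distributive ideal_quot_mul +%R.
Proof.
move=> x y z; rewrite -[x]ideal_reprK; move: (repr x) => {}x; rewrite -[y]ideal_reprK; move: (repr y) => {}y.
rewrite -[z]ideal_reprK; move: (repr z) => {}z.
by rewrite -ideal_projD !ideal_quot_mulE mulrDr ideal_projD.
Qed.

HB.instance Definition _ := GRing.Zmodule_isPzRing.Build ideal_quot
  ideal_quot_mulA ideal_quot_mul1 ideal_quot_mulr1
  ideal_quot_mulDl ideal_quot_mulDr.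

Lemma ideal_quot_scaleA a b x :
  ideal_quot_scale a (ideal_quot_scale b x) = ideal_quot_scale (a * b) x.
Proof. by rewrite -[x]ideal_reprK; move: (repr x) => {}x; rewrite !ideal_quot_scaleE scalerA. Qed.
Lemma ideal_quot_scale1 : left_id 1 ideal_quot_scale.
Proof. by move=> x; rewrite -[x]ideal_reprK; move: (repr x) => {}x; rewrite ideal_quot_scaleE scale1r. Qed.
Lemma ideal_quot_scaleDr : right_distributive ideal_quot_scale +%R.
Proof.
move=> c x y; rewrite -[x]ideal_reprK; move: (repr x) => {}x; rewrite -[y]ideal_reprK; move: (repr y) => {}y.
by rewrite -ideal_projD !ideal_quot_scaleE scalerDr ideal_projD.
Qed.
Lemma ideal_quot_scaleDl x : {morph ideal_quot_scale^~ x : a b / a + b}.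
Proof.
rewrite -[x]ideal_reprK; move: (repr x) => {}x a b.
by rewrite !ideal_quot_scaleE scalerDl ideal_projD.
Qed.

HB.instance Definition _ := GRing.Zmodule_isLmodule.Build K ideal_quot
  ideal_quot_scaleA ideal_quot_scale1 ideal_quot_scaleDr ideal_quot_scaleDl.

Lemma ideal_quot_scalerAl (c : K) (x y : ideal_quot) :
  c *: (x * y) = (c *: x) * y.
Proof.
rewrite -[x]ideal_reprK; move: (repr x) => {}x; rewrite -[y]ideal_reprK; move: (repr y) => {}y.
rewrite /GRing.scale /GRing.mul /=.
by rewrite !(ideal_quot_mulE, ideal_quot_scaleE) scalerAl.
Qed.
Lemma ideal_quot_scalerAr (c : K) (x y : ideal_quot) :
  c *: (x * y) = x * (c *: y).
Proof.
rewrite -[x]ideal_reprK; move: (repr x) => {}x; rewrite -[y]ideal_reprK; move: (repr y) => {}y.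
rewrite /GRing.scale /GRing.mul /=.
by rewrite !(ideal_quot_mulE, ideal_quot_scaleE) scalerAr.
Qed.

Lemma ideal_proj1 : ideal_proj 1 = 1. Proof. by []. Qed.
Lemma ideal_projM x y : ideal_proj (x * y) = ideal_proj x * ideal_proj y.
Proof. by rewrite -ideal_quot_mulE. Qed.
Lemma ideal_projZ c x : ideal_proj (c *: x) = c *: ideal_proj x.
Proof. by rewrite -ideal_quot_scaleE. Qed.

End IdealQuotient.

(** * Free associative algebras *)

Section FreeAlgebra.
Variables (K : fieldType) (I : choiceType).

Definition free_alg := malg (fmonom I) K.
HB.instance Definition _ := GRing.Lalgebra.on free_alg.

Lemma free_alg_scalerAr (c : K) (x y : free_alg) : c *: (x * y) = x * (c *: y).
Proof.
have commC : x * mkmalgU monalg.one c = c *: x.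
  rewrite malgM_def malgZ_def fgmulgU; apply: eq_bigr => k _.
  by rewrite mulm1 mulrC.
by rewrite -[c *: y]mul_malgC mulrA commC scalerAl.
Qed.

HB.instance Definition _ := GRing.Lalgebra_isAlgebra.Build K free_alg
  free_alg_scalerAr.

Definition free_gen (i : I) : free_alg := mkmalgU (fmu i) 1.

End FreeAlgebra.

(** * The quantum algebra U_q sl(2) *)

Section QuantumSl2.
Variables (K : fieldType) (q : K).

Notation FA := (free_alg K 'I_4).

Definition genX : FA := free_gen K (@Ordinal 4 0 isT).
Definition genY : FA := free_gen K (@Ordinal 4 1 isT).
Definition genH : FA := free_gen K (@Ordinal 4 2 isT).
Definition genHi : FA := free_gen K (@Ordinal 4 3 isT).

Definition uq_h : K := q - q^-1.

(* Each element of this set is to be set to zero. *)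
Definition uq_relations : set FA := [set r |
  [\/ r = genX * genH - q *: (genH * genX),
      r = genY * genH - q^-1 *: (genH * genY),
      r = (genX * genY - genY * genX) - uq_h^-1 *: (genH ^+ 2 - genHi ^+ 2) |
      r = genH * genHi - 1 \/ r = genHi * genH - 1]].

Definition Uqsl2 := ideal_quot uq_relations.
HB.instance Definition _ := GRing.PzRing.on Uqsl2.
HB.instance Definition _ := GRing.Lmodule.on Uqsl2.

(* The character X, Y |-> 0 and H, H^-1 |-> 1 shows that the quotient is nonzero. *)
Definition uq_eps_gen (i : 'I_4) : K := (1 < i)%N%:R.
Definition uq_eps_mon (m : fmonom 'I_4) : K := \prod_(i <- fmonom_val m) uq_eps_gen i.

Lemma uq_eps_monP : mmorphism uq_eps_mon.
Proof.
split=> [x y|]; rewrite /uq_eps_mon.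
  by rewrite fmM big_cat.
by rewrite fm1 big_nil.
Qed.
HB.instance Definition _ := monalg.isMultiplicative.Build _ _ uq_eps_mon uq_eps_monP.

Definition uq_eps : {rmorphism FA -> K} := mmap idfun uq_eps_mon.

Lemma uq_eps_genE i : uq_eps (free_gen K i) = uq_eps_gen i.
Proof. by rewrite [LHS]mmapU mul1r /= /uq_eps_mon fmU big_seq1. Qed.

Lemma uq_epsZ c x : uq_eps (c *: x) = c * uq_eps x.
Proof. exact: mmapZ. Qed.

Lemma uq_epsM x y : uq_eps (x * y) = uq_eps x * uq_eps y.
Proof. exact: rmorphM. Qed.

Lemma uq_epsB x y : uq_eps (x - y) = uq_eps x - uq_eps y.
Proof. exact: rmorphB. Qed.

Lemma uq_eps1 : uq_eps 1 = 1.
Proof. exact: rmorph1. Qed.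

Lemma uq_eps_gens :
  [/\ uq_eps genX = 0, uq_eps genY = 0, uq_eps genH = 1 & uq_eps genHi = 1].
Proof. by split; rewrite uq_eps_genE. Qed.

Lemma uq_eps_relations r : uq_relations r -> uq_eps r = 0.
Proof.
rewrite /uq_relations /=; have [] := uq_eps_gens.
move: genX genY genH genHi => X Y H Hi eX eY eH eHi.
case=> [->|->|->|[]->];
  rewrite ?expr2 !(uq_epsB, uq_epsZ, uq_epsM, uq_eps1) ?eX ?eY ?eH ?eHi.
- by rewrite !(mul0r, mulr0) subrr.
- by rewrite !(mul0r, mulr0) subrr.
- by rewrite !mulr0 !mulr1 !subrr mulr0 subrr.
- by rewrite mulr1 subrr.
- by rewrite mulr1 subrr.
Qed.

Lemma Uqsl2_1_neq0 : (1 : Uqsl2) != 0.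
Proof.
rewrite -[0](subrr (1 : Uqsl2)) -ideal_proj1 -ideal_projB ideal_projP subrr subr0.
apply/negP => /asboolP[s Ss /(congr1 uq_eps)/eqP].
rewrite rmorph1 rmorph_sum big_seq big1 ?oner_eq0 // => t /Ss St.
by rewrite !uq_epsM (uq_eps_relations St) mulr0 mul0r.
Qed.

HB.instance Definition _ := GRing.PzSemiRing_isNonZero.Build Uqsl2 Uqsl2_1_neq0.
HB.instance Definition _ := GRing.LSemiModule_isLSemiAlgebra.Build K Uqsl2
  (@ideal_quot_scalerAl _ _ uq_relations).
HB.instance Definition _ := GRing.Lalgebra_isAlgebra.Build K Uqsl2
  (@ideal_quot_scalerAr _ _ uq_relations).

Definition uqX : Uqsl2 := ideal_proj uq_relations genX.
Definition uqY : Uqsl2 := ideal_proj uq_relations genY.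
Definition uqH : Uqsl2 := ideal_proj uq_relations genH.
Definition uqHi : Uqsl2 := ideal_proj uq_relations genHi.

Definition casimir : Uqsl2 :=
  uqY * uqX
  - uq_h^-1 *: ((q ^+ 2 - 1)^-1 *: uqH ^+ 2 - (q ^- 2 - 1)^-1 *: uqHi ^+ 2).

End QuantumSl2.

(** * The base change [L (x)_K A] *)

Section BaseChange.
Variables (K : fieldType) (L : fieldType) (iota : {rmorphism K -> L}).
Variable A : algType K.

(* A sequence [:: (l1, a1); ...; (ln, an)] stands for
   l1 (x) a1 + ... + ln (x) an; two of them are identified when they are
   related by the bilinearity relations defining the tensor product. *)
Inductive tens_eq : seq (L * A) -> seq (L * A) -> Prop :=
| tens_refl s : tens_eq s s
| tens_sym s t : tens_eq s t -> tens_eq t s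
| tens_trans s t u : tens_eq s t -> tens_eq t u -> tens_eq s u
| tens_cat s s' t t' :
    tens_eq s s' -> tens_eq t t' -> tens_eq (s ++ t) (s' ++ t')
| tens_catC s t : tens_eq (s ++ t) (t ++ s)
| tens_0 a : tens_eq [:: (0, a)] [::]
| tens_Dl l l' a : tens_eq [:: (l + l', a)] [:: (l, a); (l', a)]
| tens_Dr l a a' : tens_eq [:: (l, a + a')] [:: (l, a); (l, a')]
| tens_Z k l a : tens_eq [:: (l, k *: a)] [:: (l * iota k, a)].

Definition tens_rel (s t : seq (L * A)) : bool := `[< tens_eq s t >].

Lemma tens_rel_equiv : equiv_class_of tens_rel.
Proof.
split=> [s|s t|t s u]; first exact/asboolP/tens_refl.
  by apply/asboolP/asboolP => /tens_sym.
by move=> /asboolP st /asboolP tu; apply/asboolP/(tens_trans st).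
Qed.

Canonical tens_equiv := EquivRelPack tens_rel_equiv.
Canonical tens_encModRel := defaultEncModRel tens_rel.

Definition base_change := {eq_quot tens_rel}.
HB.instance Definition _ := EqQuotient.on base_change.
HB.instance Definition _ := Choice.on base_change.

Definition tens (s : seq (L * A)) : base_change := \pi_base_change s.

(* l (x) a *)
Definition pure (l : L) (a : A) : base_change := tens [:: (l, a)].

Lemma tensP s t : tens_eq s t -> tens s = tens t.
Proof. by move=> st; apply/eqP; rewrite piE; apply/asboolP. Qed.

Lemma tens_eqP s t : tens s = tens t -> tens_eq s t.
Proof. by move=> /eqP; rewrite piE => /asboolP. Qed.

Lemma tens_reprK x : tens (repr x) = x.
Proof. exact: reprK. Qed.

Lemma tens_repr s : tens_eq (repr (tens s)) s.
Proof. exact/tens_eqP/tens_reprK. Qed.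

Definition seq_scale (c : L) (s : seq (L * A)) := [seq (c * x.1, x.2) | x <- s].
Definition seq_mul (s t : seq (L * A)) :=
  [seq (x.1 * y.1, x.2 * y.2) | x <- s, y <- t].

Lemma seq_mul_catl s s' t : seq_mul (s ++ s') t = seq_mul s t ++ seq_mul s' t.
Proof. exact: allpairs_cat. Qed.

Lemma tens_catACA s t u v :
  tens_eq ((s ++ t) ++ (u ++ v)) ((s ++ u) ++ (t ++ v)).
Proof.
rewrite -!catA; apply: tens_cat; first exact: tens_refl.
by rewrite !catA; apply: tens_cat; [exact: tens_catC|exact: tens_refl].
Qed.

Lemma seq_mul_catr s t t' :
  tens_eq (seq_mul s (t ++ t')) (seq_mul s t ++ seq_mul s t').
Proof.
elim: s => [|x s IHs]; first exact: tens_refl.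
rewrite -cat1s !(seq_mul_catl [:: x] s).
apply: tens_trans (tens_catACA _ _ _ _); apply: tens_cat => //.
by rewrite /seq_mul /= map_cat !cats0; apply: tens_refl.
Qed.

Lemma seq_scale_eq c s t : tens_eq s t -> tens_eq (seq_scale c s) (seq_scale c t).
Proof.
elim=> {s t}; rewrite /seq_scale.
- by move=> s; apply: tens_refl.
- by move=> s t _; apply: tens_sym.
- by move=> s t u _ st _; apply: tens_trans.
- by move=> s s' t t' _ ss' _ tt'; rewrite !map_cat; apply: tens_cat.
- by move=> s t; rewrite !map_cat; apply: tens_catC.
- by move=> a /=; rewrite mulr0; apply: tens_0.
- by move=> l l' a /=; rewrite mulrDr; apply: tens_Dl.
- by move=> l a a'; apply: tens_Dr.
- by move=> k l a /=; rewrite mulrA; apply: tens_Z.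
Qed.

Lemma seq_mul_eql s t u : tens_eq s t -> tens_eq (seq_mul s u) (seq_mul t u).
Proof.
elim=> {s t}.
- by move=> s; apply: tens_refl.
- by move=> s t _; apply: tens_sym.
- by move=> s t v _ st _; apply: tens_trans.
- by move=> s s' t t' _ ss' _ tt'; rewrite !seq_mul_catl; apply: tens_cat.
- by move=> s t; rewrite !seq_mul_catl; apply: tens_catC.
- move=> a; elim: u => [|y u IHu]; first exact: tens_refl.
  apply: (tens_trans (seq_mul_catr _ [:: y] u)).
  apply: (@tens_cat _ [::] _ [::]) => //.
  by rewrite /seq_mul /= mul0r; apply: tens_0.
- move=> l l' a; elim: u => [|y u IHu]; first exact: tens_refl.
  apply: (tens_trans (seq_mul_catr _ [:: y] u)).
  apply: tens_trans (tens_sym (seq_mul_catr _ [:: y] u)).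
  by apply: (tens_cat _ IHu); rewrite /seq_mul /= mulrDl; apply: tens_Dl.
- move=> l a a'; elim: u => [|y u IHu]; first exact: tens_refl.
  apply: (tens_trans (seq_mul_catr _ [:: y] u)).
  apply: tens_trans (tens_sym (seq_mul_catr _ [:: y] u)).
  by apply: (tens_cat _ IHu); rewrite /seq_mul /= mulrDl; apply: tens_Dr.
- move=> k l a; elim: u => [|y u IHu]; first exact: tens_refl.
  apply: (tens_trans (seq_mul_catr _ [:: y] u)).
  apply: tens_trans (tens_sym (seq_mul_catr _ [:: y] u)).
  apply: (tens_cat _ IHu); rewrite /seq_mul /= -scalerAl mulrAC.
  exact: tens_Z.
Qed.

Lemma seq_mul_eqr s t u : tens_eq s t -> tens_eq (seq_mul u s) (seq_mul u t).
Proof.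
move=> st; elim: u => [|y u IHu]; first exact: tens_refl.
rewrite -cat1s !(seq_mul_catl [:: y] u); apply: (tens_cat _ IHu) => {u IHu}.
rewrite /seq_mul /= !cats0; elim: st => {s t}.
- by move=> s; apply: tens_refl.
- by move=> s t _; apply: tens_sym.
- by move=> s t v _ st _; apply: tens_trans.
- by move=> s s' t t' _ ss' _ tt'; rewrite !map_cat; apply: tens_cat.
- by move=> s t; rewrite !map_cat; apply: tens_catC.
- by move=> a /=; rewrite mulr0; apply: tens_0.
- by move=> l l' a /=; rewrite mulrDr; apply: tens_Dl.
- by move=> l a a' /=; rewrite mulrDr; apply: tens_Dr.
- by move=> k l a /=; rewrite -scalerAr mulrA; apply: tens_Z.
Qed.

Definition bc_zero : base_change := tens [::].
Definition bc_add (x y : base_change) := tens (repr x ++ repr y).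
Definition bc_scale (c : L) (x : base_change) := tens (seq_scale c (repr x)).
Definition bc_opp (x : base_change) := bc_scale (-1) x.
Definition bc_one : base_change := pure 1 1.
Definition bc_mul (x y : base_change) := tens (seq_mul (repr x) (repr y)).

Lemma bc_addE s t : bc_add (tens s) (tens t) = tens (s ++ t).
Proof. by apply/tensP/tens_cat; apply: tens_repr. Qed.
Lemma bc_scaleE c s : bc_scale c (tens s) = tens (seq_scale c s).
Proof. exact/tensP/seq_scale_eq/tens_repr. Qed.
Lemma bc_mulE s t : bc_mul (tens s) (tens t) = tens (seq_mul s t).
Proof.
apply: tensP; apply: (@tens_trans _ (seq_mul s (repr (tens t)))).
  exact/seq_mul_eql/tens_repr.
exact/seq_mul_eqr/tens_repr.
Qed.

Lemma bc_addA : associative bc_add.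
Proof.
move=> x y z; rewrite -[x]tens_reprK -[y]tens_reprK -[z]tens_reprK.
by rewrite !bc_addE catA.
Qed.
Lemma bc_addC : commutative bc_add.
Proof.
move=> x y; rewrite -[x]tens_reprK -[y]tens_reprK !bc_addE.
exact/tensP/tens_catC.
Qed.
Lemma bc_add0 : left_id bc_zero bc_add.
Proof. by move=> x; rewrite -[x]tens_reprK bc_addE. Qed.
Lemma bc_addN : left_inverse bc_zero bc_opp bc_add.
Proof.
move=> x; rewrite -[x]tens_reprK /bc_opp bc_scaleE bc_addE; apply: tensP.
elim: (repr x) => [|[l a] s IHs]; first exact: tens_refl.
rewrite -[(l, a) :: s]cat1s {1}/seq_scale map_cat.
apply: (tens_trans (tens_catACA _ _ _ _)).
rewrite -[[::]]cats0; apply: tens_cat => //=.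
apply: tens_trans (tens_0 a); apply: tens_sym; rewrite mulN1r.
by rewrite -{1}(addNr l); apply: tens_Dl.
Qed.

HB.instance Definition _ := GRing.isZmodule.Build base_change
  bc_addA bc_addC bc_add0 bc_addN.

Lemma tens_add s t : tens (s ++ t) = tens s + tens t.
Proof. by rewrite -bc_addE. Qed.

Lemma seq_mulA s t u : seq_mul s (seq_mul t u) = seq_mul (seq_mul s t) u.
Proof.
elim: s => // x s IHs; rewrite -cat1s !seq_mul_catl IHs; congr (_ ++ _).
rewrite /seq_mul /= !cats0 map_allpairs.
elim: t {IHs} => //= y t ->; congr (_ ++ _).
by apply: eq_map => z /=; rewrite !mulrA.
Qed.

Lemma bc_mulA : associative bc_mul.
Proof.
move=> x y z; rewrite -[x]tens_reprK -[y]tens_reprK -[z]tens_reprK.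
by rewrite !bc_mulE seq_mulA.
Qed.
Lemma bc_mul1 : left_id bc_one bc_mul.
Proof.
move=> x; rewrite -[x]tens_reprK bc_mulE; congr tens; rewrite /seq_mul /= cats0.
by rewrite -[RHS]map_id; apply: eq_map => -[l a] /=; rewrite !mul1r.
Qed.
Lemma bc_mulr1 : right_id bc_one bc_mul.
Proof.
move=> x; rewrite -[x]tens_reprK bc_mulE; congr tens.
rewrite /seq_mul allpairs1r -[RHS]map_id.
by apply: eq_map => -[l a] /=; rewrite !mulr1.
Qed.
Lemma bc_mulDl : left_distributive bc_mul +%R.
Proof.
move=> x y z; rewrite -[x]tens_reprK -[y]tens_reprK -[z]tens_reprK.
by rewrite -tens_add !bc_mulE seq_mul_catl tens_add.
Qed.
Lemma bc_mulDr : right_distributive bc_mul +%R.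
Proof.
move=> x y z; rewrite -[x]tens_reprK -[y]tens_reprK -[z]tens_reprK.
by rewrite -tens_add !bc_mulE -tens_add; apply/tensP/seq_mul_catr.
Qed.

HB.instance Definition _ := GRing.Zmodule_isPzRing.Build base_change
  bc_mulA bc_mul1 bc_mulr1 bc_mulDl bc_mulDr.

Lemma bc_scaleA a b x : bc_scale a (bc_scale b x) = bc_scale (a * b) x.
Proof.
rewrite -[x]tens_reprK !bc_scaleE; congr tens; rewrite /seq_scale -map_comp.
by apply: eq_map => -[l c] /=; rewrite mulrA.
Qed.
Lemma bc_scale1 : left_id 1 bc_scale.
Proof.
move=> x; rewrite -[x]tens_reprK bc_scaleE; congr tens.
by rewrite -[RHS]map_id; apply: eq_map => -[l a] /=; rewrite mul1r.
Qed.
Lemma bc_scaleDr : right_distributive bc_scale +%R.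
Proof.
move=> c x y; rewrite -[x]tens_reprK -[y]tens_reprK -tens_add !bc_scaleE.
by rewrite -tens_add /seq_scale map_cat.
Qed.
Lemma bc_scaleDl x : {morph bc_scale^~ x : a b / a + b}.
Proof.
move=> a b; rewrite -[x]tens_reprK !bc_scaleE -tens_add; apply: tensP.
elim: (repr x) => [|[l c] s IHs]; first exact: tens_refl.
rewrite -[(l, c) :: s]cat1s /seq_scale !map_cat.
apply: tens_trans (tens_catACA _ _ _ _); apply: tens_cat => //=.
by rewrite mulrDl; apply: tens_Dl.
Qed.

HB.instance Definition _ := GRing.Zmodule_isLmodule.Build L base_change
  bc_scaleA bc_scale1 bc_scaleDr bc_scaleDl.

End BaseChange.

(** * The Dixmier partition and the centralizer conditions *)

Section Dixmier.
Variables (K L : fieldType) (iota : {rmorphism K -> L}) (A : algType K).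
Implicit Types a b : A.

Definition ad (R : pzRingType) (a b : R) : R := a * b - b * a.

Definition center : set A := [set z | forall b, z * b = b * z].

Definition noncommutative : Prop := exists a b, a * b <> b * a.

Definition span (V : lmodType K) (s : seq V) : set V :=
  [set x | exists c : 'I_(size s) -> K, x = \sum_(i < size s) c i *: s`_i].

Definition finite_dimensional (V : lmodType K) (W : set V) : Prop :=
  exists s : seq V, W = span s.

Definition centralizer a : set A := [set b | ad a b = 0].

Definition nil_set a : set A := [set b | exists i, iter i.+1 (ad a) b = 0].

(* [base_change iota A] is the algebra obtained from A by extending the
   scalars along iota, and [pure iota 1 a] is the image 1 (x) a of a in it.
   The eigenspaces of an operator being independent, membership in their
   direct sum is being a finite sum of eigenvectors. *)
Definition diag_set a : set A := [set b |
  exists (n : nat) (lambda : 'I_n -> L) (v : 'I_n -> base_change iota A),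
    (forall i, ad (pure iota 1 a) (v i) = lambda i *: v i) /\
    pure iota 1 b = \sum_(i < n) v i].

(* The subspace K[ad a] b of A. *)
Definition ad_orbit a b : set A :=
  [set x | exists p : {poly K}, x = \sum_(i < size p) p`_i *: iter i (ad a) b].

Definition fin_set a : set A := [set b | finite_dimensional (ad_orbit a b)].

Definition strongly_nilpotent : set A := [set a |
  [/\ ~ center a, nil_set a = setT & diag_set a = centralizer a]].

Definition weakly_nilpotent : set A := [set a |
  [/\ ~ center a, centralizer a <> nil_set a, nil_set a <> setT
    & diag_set a = centralizer a]].

Definition strongly_semisimple : set A := [set a |
  [/\ ~ center a, nil_set a = centralizer a & diag_set a = setT]].

Definition weakly_semisimple : set A := [set a |
  [/\ ~ center a, nil_set a = centralizer a, centralizer a <> diag_set a,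
      diag_set a = fin_set a & fin_set a <> setT]].

Definition generic : set A := [set a |
  [/\ ~ center a, nil_set a = centralizer a & diag_set a = centralizer a]].

Definition dixmier_partition : Prop :=
  ~` center = strongly_nilpotent `|` weakly_nilpotent `|` strongly_semisimple
              `|` weakly_semisimple `|` generic.

Definition commutative_centralizer_condition : Prop :=
  noncommutative /\
  forall a, ~ center a ->
    forall b c, centralizer a b -> centralizer a c -> b * c = c * b.

(* The subset K^* a + Z(A). *)
Definition punctured_line a : set A :=
  [set b | exists (k : K) (z : A), [/\ k != 0, center z & b = k *: a + z]].

(* All the elements of the set E are generic, except for a subset
   K^* a' + Z(A) of elements of type T, where a' is itself of type T. *)
Definition generic_but (T E : set A) : Prop :=
  exists2 a', T a' &
    [/\ punctured_line a' `<=` E, punctured_line a' `<=` T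
      & E `\` punctured_line a' `<=` generic].

Definition centralizer_kind (E : set A) (i : 'I_5) : Prop :=
  match val i with
  | 0 => E `<=` strongly_nilpotent
  | 1 => E `<=` weakly_nilpotent
  | 2 => generic_but strongly_semisimple E
  | 3 => generic_but weakly_semisimple E
  | _ => E `<=` generic
  end.

Definition homogeneous_centralizer_condition : Prop :=
  [/\ noncommutative, dixmier_partition &
    forall a, ~ center a ->
      exists! i, centralizer_kind (centralizer a `\` center) i].

End Dixmier.

Arguments center {K} A.

(** * The Gelfand-Kirillov dimension *)

Section GelfandKirillov.
Variables (R : realType) (K : fieldType) (A : algType K).

(* The sub-family of s indexed by J is linearly independent. *)
Definition independent (s : seq A) (J : {set 'I_(size s)}) : Prop :=
  forall c : 'I_(size s) -> K,
    \sum_(i in J) c i *: s`_i = 0 -> forall i, i \in J -> c i = 0.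

(* The dimension of the subspace spanned by s. *)
Definition dim_span (s : seq A) : nat :=
  \max_(J : {set 'I_(size s)} | `[< independent J >]) #|J|.

(* A family spanning V^0 + V^1 + ... + V^n, where V is the span of s. *)
Fixpoint words (s : seq A) (n : nat) : seq A :=
  if n is n'.+1 then words s n' ++ [seq x * y | x <- s, y <- words s n']
  else [:: 1].

(* The supremum, over the finite-dimensional subspaces V of A, of the upper
   limits of log_n (dim (V^0 + ... + V^n)). *)
Definition GKdim : \bar R :=
  ereal_sup [set limn_esup (fun n : nat =>
                   (ln ((dim_span (words s n))%:R : R) / ln (n%:R : R))%:E)
            | s in [set: seq A]].

End GelfandKirillov.

(** * Division rings of fractions and subalgebras *)

Section Fractions.
Variables (K : fieldType) (U : algType K) (Q : unitAlgType K).

(* j makes Q the (two-sided) division ring of fractions of U. *)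
Definition is_division_ring_of_fractions (j : {lrmorphism U -> Q}) : Prop :=
  [/\ injective j,
      forall x : Q, x != 0 -> x \is a GRing.unit,
      forall x : Q, exists a b, b != 0 /\ x = j a / j b
    & forall x : Q, exists a b, b != 0 /\ x = (j b)^-1 * j a].

(* The subfield K(c) of Q: the fractions of K[c]. *)
Definition rational_in (c : Q) : set Q :=
  [set x | exists f g : {poly K},
     horner_alg c g != 0 /\ x = horner_alg c f / horner_alg c g].

Definition scalars : set Q := [set x | exists k : K, x = k%:A].

End Fractions.

Arguments scalars {K} Q.

(* The algebra structure inherited by a subalgebra S of Q. *)
Section Subalgebra.
Variables (K : fieldType) (Q : algType K) (S : subalgClosed Q).

Definition subalgebra := {x : Q | x \in S}.
HB.instance Definition _ := SubChoice.on subalgebra.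
HB.instance Definition _ := [SubChoice_isSubAlgebra of subalgebra by <:].

End Subalgebra.

(* Main.v *)
From HB Require Import structures.
Require Import Defs.
From mathcomp Require Import all_boot all_order all_algebra zify ring.
From mathcomp Require Import boolp classical_sets reals ereal sequences exp.
From mathcomp Require Import -(notations) monalg.

Set Implicit Arguments.
Unset Strict Implicit.
Unset Printing Implicit Defensive.

Import Order.TTheory GRing.Theory Num.Theory.
Local Open Scope ring_scope.

(** The idea is to compute in a division ring [L] of iterated Laurent series
    over the algebraic closure.  Let k be the field of rational functions in one
    variable c over [Kbar], let D = k((h)) be the field of Laurent series in h,
    and let [L] be the ring of skew Laurent series in x over D in which
    x h = q h x.  Let g(h) be the combination of h^2 and h^-2 such that the
    Casimir element of U_q sl(2) is YX - g(H).  Sending X to x, H to h and Y to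
    (c + g(h)) x^-1 respects the defining relations and sends the Casimir element
    to c.  Multiplied by high enough powers of H on the left and of X on the
    right, every element of U_q sl(2) becomes a combination of elements
    f(C) H^j X^i ([nf_exists]), and these have independent images
    ([nf_coords]).  Hence the map is injective, and it extends to the division
    ring of fractions ([fraction_extension]).

    Three properties of [L] then give everything.

    - The centralizer of a series that is not a constant of k is commutative
      ([centralizer_comm]).  The order in x is a valuation, and two elements of
      the same order that commute with a series of nonzero order have leading
      coefficients whose ratio is fixed by a power of h |-> q h.  As q is not a
      root of 1, the ratio is in k.  So every element of the centralizer is, to any
      precision, a combination over k of powers of one element of minimal
      positive order.

    - The only element of k that is a commutator is 0 ([trace_comm]).  The
      coefficient of h^0 x^0 is a trace: it takes the same value on uv and on vu.

    - An element of the division ring of fractions that is sent into k is in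
      K(C): compare the coefficients of numerator and denominator
      ([nf_embedding_ratio]).

    The first property gives the commutative centralizer condition, and together
    with the third it gives the centre.  The second one determines the types.
    If w = [a, b] is nonzero and commutes with a, then [a, b w^-1] = 1; and if
    [a, v] = l v with v nonzero, then l = [v^-1, v a].  So in [L] no nonzero
    commutator [a, b] commutes with a, and no l in [Kbar] other than 0 is an
    eigenvalue of [a, -].  The base change to [Kbar] of a subalgebra of the
    division ring of fractions also maps to [L] ([bc_eval]), so eigenvectors of
    nonzero eigenvalue contribute nothing to the image of an element of D(a).
    Hence N(a) = D(a) = C(a): in any noncommutative subalgebra all noncentral
    elements are generic, and the homogeneous centralizer condition holds in its
    fifth form. *)

(** * Finite sums over the integers *)

Section IntegerSums.
Variable V : nmodType.
Implicit Types (F G : int -> V) (s t : seq int) (n : nat).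

Definition window n : seq int := [seq k%:Z - n%:Z | k <- iota 0 (n + n).+1].

Lemma mem_window n (i : int) : (i \in window n) = (`|i|%N <= n)%N.
Proof.
apply/mapP/idP => [[k]|le_in].
  by rewrite mem_iota => /andP[_ ?] ->; lia.
by exists (absz (i + n%:Z)); [rewrite mem_iota; lia | lia].
Qed.

Lemma window_uniq n : uniq (window n).
Proof. by rewrite map_inj_uniq ?iota_uniq // => k l; lia. Qed.

Lemma sum_cover F s t : uniq s -> uniq t ->
    {in s, forall i, i \notin t -> F i = 0} ->
    {in t, forall i, i \notin s -> F i = 0} ->
  \sum_(i <- s) F i = \sum_(i <- t) F i.
Proof.
move=> us ut st ts.
rewrite (bigID (mem t)) /= [X in _ + X]big1_seq ?addr0; last first.
  by move=> i /andP[ti si]; apply: st.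
rewrite [RHS](bigID (mem s)) /= [X in _ = _ + X]big1_seq ?addr0; last first.
  by move=> i /andP[si ti]; apply: ts.
rewrite -big_filter -[RHS]big_filter; apply: perm_big.
apply: uniq_perm; rewrite ?filter_uniq // => i.
by rewrite !mem_filter andbC.
Qed.

(** The sum of a function of finite support. The bound [n] of the support is
    chosen arbitrarily; by [sum_cover] it does not affect the sum. *)
Definition zsum F : V :=
  \sum_(i <- window (xget 0%N [set n | forall i, F i <> 0 -> (`|i| <= n)%N])) F i.

Lemma zsumE F s : uniq s -> (forall i, F i <> 0 -> i \in s) ->
  zsum F = \sum_(i <- s) F i.
Proof.
move=> us Fs; rewrite /zsum; case: xgetP => [n _ Fn|/(_ (\sum_(i <- s) `|i|%N)%N)].
  apply: sum_cover; rewrite ?window_uniq // => i _; rewrite ?mem_window;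
  by apply: contraNP => /[dup] /Fs + /Fn.
case=> i /Fs; move: (us) => _; elim: s {us Fs} => // j s IHs.
by rewrite inE big_cons => /predU1P[->|/IHs]; lia.
Qed.

Lemma zsum_window F n : (forall i, F i <> 0 -> (`|i| <= n)%N) ->
  zsum F = \sum_(i <- window n) F i.
Proof. by move=> Fn; apply: zsumE; rewrite ?window_uniq// => i; rewrite mem_window; apply: Fn. Qed.

Lemma zsum1 F i0 : (forall i, i <> i0 -> F i = 0) -> zsum F = F i0.
Proof.
move=> F0; rewrite (@zsumE F [:: i0]) ?big_seq1 // => i Fi.
by rewrite inE; apply/eqP; apply: contra_notP Fi; apply: F0.
Qed.

Lemma zsum_shift F a n : (forall i, F i <> 0 -> (`|i| <= n)%N) ->
  zsum (fun i => F (i + a)) = zsum F.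
Proof.
move=> Fn; rewrite (@zsumE F [seq i + a | i <- window (n + `|a|)]).
- rewrite big_map; apply: zsum_window => i /Fn; lia.
- by rewrite map_inj_uniq ?window_uniq //; apply: addIr.
- move=> i /Fn ?; apply/mapP; exists (i - a); rewrite ?subrK //.
  by rewrite mem_window; lia.
Qed.

Lemma zsum_reflect F a n : (forall i, F i <> 0 -> (`|i| <= n)%N) ->
  zsum (fun i => F (a - i)) = zsum F.
Proof.
move=> Fn; rewrite (@zsumE F [seq a - i | i <- window (n + `|a|)]).
- rewrite big_map; apply: zsum_window => i /Fn; lia.
- by rewrite map_inj_uniq ?window_uniq // => i j; lia.
- move=> i /Fn ?; apply/mapP; exists (a - i); rewrite ?subKr //.
  by rewrite mem_window; lia.
Qed.

End IntegerSums.

(** * Skew Laurent series *)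

(** An action of the integers on [D] by ring endomorphisms, hence by
    automorphisms. Indexing by integers gives the inverse automorphism for free
    when negative powers of the variable are moved past a coefficient. *)
Record twist (D : nzRingType) := Twist {
  tw :> int -> {rmorphism D -> D};
  tw0 : forall d, tw 0 d = d;
  twD : forall m n d, tw (m + n) d = tw m (tw n d) }.

Definition bounded_below (D : nzRingType) (f : int -> D) : bool :=
  `[< exists N, forall i, i < N -> f i = 0 >].

Record laurent (D : nzRingType) (t : twist D) :=
  Laurent { coef :> int -> D; _ : bounded_below coef }.

Section Laurent.
Variables (D : nzRingType) (t : twist D).
Local Notation laurent := (laurent t).
Local Notation Laurent := (@Laurent D t _).

HB.instance Definition _ := [isSub for @coef D t].
HB.instance Definition _ := [Choice of laurent by <:].

Definition ord_ge (f : int -> D) (N : int) := forall i, i < N -> f i = 0.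

Lemma ord_geP (f : laurent) : exists N, ord_ge f N.
Proof. by case: f => f fb /=; apply/asboolP. Qed.

Lemma laurentP (f g : laurent) : (forall i, f i = g i) -> f = g.
Proof. by move=> fg; apply/val_inj/funext. Qed.

Lemma ord_geW f M N : M <= N -> ord_ge f N -> ord_ge f M.
Proof. by move=> leMN fN i lt_iM; apply: fN; apply: lt_le_trans leMN. Qed.

Lemma bounded_belowP f N : ord_ge f N -> bounded_below f.
Proof. by move=> fN; apply/asboolP; exists N. Qed.

Definition series_of f N (fN : ord_ge f N) : laurent := Laurent (bounded_belowP fN).

Definition zero_lau := @series_of (fun => 0) 0 (fun i _ => erefl).

Lemma add_lau_subproof (f g : laurent) : bounded_below (fun i => f i + g i).
Proof.
have [[M fM] [N gN]] := (ord_geP f, ord_geP g).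
apply: (@bounded_belowP _ (Num.min M N)) => i lt_i.
by rewrite fM ?gN ?addr0 //; lia.
Qed.
Definition add_lau f g := Laurent (add_lau_subproof f g).

Lemma opp_lau_subproof (f : laurent) : bounded_below (fun i => - f i).
Proof.
have [N fN] := ord_geP f; apply: (@bounded_belowP _ N) => i /fN ->.
exact: oppr0.
Qed.
Definition opp_lau f := Laurent (opp_lau_subproof f).

Lemma add_lauA : associative add_lau.
Proof. by move=> f g h; apply: laurentP => i /=; rewrite addrA. Qed.
Lemma add_lauC : commutative add_lau.
Proof. by move=> f g; apply: laurentP => i /=; rewrite addrC. Qed.
Lemma add_lau0 : left_id zero_lau add_lau.
Proof. by move=> f; apply: laurentP => i /=; rewrite add0r. Qed.
Lemma add_lauN : left_inverse zero_lau opp_lau add_lau.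
Proof. by move=> f; apply: laurentP => i /=; rewrite addNr. Qed.
HB.instance Definition _ :=
  GRing.isZmodule.Build laurent add_lauA add_lauC add_lau0 add_lauN.

Lemma lcoefD (f g : laurent) i : (f + g) i = f i + g i. Proof. by []. Qed.
Lemma lcoefB (f g : laurent) i : (f - g) i = f i - g i. Proof. by []. Qed.

(** The coefficient of x^n in a product, from the rule x^i d = t^i(d) x^i. *)
Definition mul_coef (f g : int -> D) (n : int) : D :=
  zsum (fun i => f i * t i (g (n - i))).

Lemma mul_coef_supp f g M N n : ord_ge f M -> ord_ge g N ->
  forall i, f i * t i (g (n - i)) <> 0 -> M <= i <= n - N.
Proof.
move=> fM gN i nz; apply/andP; split; rewrite leNgt; apply/negP => lt_i; case: nz.
  by rewrite fM ?mul0r.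
by rewrite gN ?rmorph0 ?mulr0 //; lia.
Qed.

Lemma mul_coef_ge f g M N : ord_ge f M -> ord_ge g N ->
  ord_ge (mul_coef f g) (M + N).
Proof.
move=> fM gN n lt_n; rewrite /mul_coef (zsumE (s := [::])) ?big_nil //.
by move=> i /(mul_coef_supp fM gN); lia.
Qed.

Lemma mul_coef_lead f g M N : ord_ge f M -> ord_ge g N ->
  mul_coef f g (M + N) = f M * t M (g N).
Proof.
move=> fM gN; rewrite /mul_coef (zsum1 (i0 := M)) 1?addrC ?addKr // => i neq_iM.
by apply/eqP/negP => /negP/eqP /(mul_coef_supp fM gN); lia.
Qed.

Lemma mul_lau_subproof (f g : laurent) : bounded_below (mul_coef f g).
Proof.
have [[M fM] [N gN]] := (ord_geP f, ord_geP g).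
exact: bounded_belowP (mul_coef_ge fM gN).
Qed.
Definition mul_lau f g := Laurent (mul_lau_subproof f g).

Definition mono_fun (d : D) (n i : int) : D := if i == n then d else 0.
Lemma mono_ge d n : ord_ge (mono_fun d n) n.
Proof. by move=> i; rewrite /mono_fun; case: eqP => // ->; rewrite ltxx. Qed.
Definition mono d n : laurent := series_of (@mono_ge d n).

Lemma mul_coef_window (f g : int -> D) M N n R : ord_ge f M -> ord_ge g N ->
    (`|M| <= R)%N -> (`|N| <= R)%N -> (`|n| <= R)%N ->
  mul_coef f g n = \sum_(i <- window (R + R)) f i * t i (g (n - i)).
Proof.
move=> fM gN ? ? ?; apply: zsum_window => i /(mul_coef_supp fM gN); lia.
Qed.

(** Both triple products are the sum over i and j of
    f_i t^i(g_(j-i)) t^j(h_(n-j)), where only finitely many (i, j) contribute: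
    the two iterated sums are exchanged over a common finite range, and the shift by i
    relates the inner sum to the coefficients of [g * h]. *)
Lemma mul_lauA : associative mul_lau.
Proof.
move=> f g h; apply: laurentP => n.
have [[a fa] [[b gb] [c hc]]] := (ord_geP f, (ord_geP g, ord_geP h)).
have [fg gh] := (mul_coef_ge fa gb, mul_coef_ge gb hc).
pose R := (`|n| + `|a| + `|b| + `|c|)%N.
pose F i j := f i * t i (g (j - i)) * t j (h (n - j)).
have F0 i j : F i j <> 0 -> a <= i /\ i + b <= j <= n - c.
  move=> nz; have ?: a <= i.
    rewrite leNgt; apply/negP => lt_i; case: nz.
    by rewrite /F fa ?mul0r.
  split=> //; apply/andP; split; rewrite leNgt; apply/negP => lt_i; case: nz.
    by rewrite /F gb ?rmorph0 ?mulr0 ?mul0r //; lia.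
  by rewrite /F hc ?rmorph0 ?mulr0 //; lia.
transitivity (\sum_(i <- window (R + R)) zsum (F i)).
  rewrite /= (mul_coef_window (R := R) fa gh) ?/R //; [|lia|lia|lia].
  rewrite !big_seq; apply: eq_bigr => i; rewrite mem_window => le_i.
  rewrite -(@zsum_shift _ (F i) i (R + R + R)%N); last first.
    by move=> j /F0; rewrite /R; lia.
  rewrite (zsum_window (n := (R + R + R + R + R)%N)); last first.
    by move=> j /F0; rewrite /R; lia.
  rewrite {1}/mul_coef (zsum_window (n := (R + R + R + R + R)%N)); last first.
    by move=> j /(mul_coef_supp gb hc); lia.
  rewrite rmorph_sum /= mulr_sumr; apply: eq_bigr => j _.
  by rewrite /F rmorphM -twD addrK mulrA (addrC i j) opprD addrA addrAC.
transitivity (\sum_(j <- window (R + R)) zsum (F^~ j)).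
  transitivity (\sum_(i <- window (R + R)) \sum_(j <- window (R + R)) F i j).
    by apply: eq_bigr => i _; apply: zsum_window => j /F0; rewrite /R; lia.
  rewrite exchange_big; apply: eq_bigr => j _.
  by apply/esym/zsum_window => i /F0; rewrite /R; lia.
rewrite /= (mul_coef_window (R := R) fg hc) ?/R //; [|lia|lia|lia].
rewrite !big_seq; apply: eq_bigr => j; rewrite mem_window => le_j.
rewrite (zsum_window (n := (R + R + R + R)%N)); last first.
  by move=> i /F0; rewrite /R; lia.
rewrite /mul_coef (zsum_window (n := (R + R + R + R)%N)) ?mulr_suml //.
by move=> i /(mul_coef_supp fa gb); rewrite /R; lia.
Qed.

Lemma coef_mono d n i : mono d n i = if i == n then d else 0.
Proof. by []. Qed.

Lemma mul_mono_coef d n (f : laurent) i : mul_lau (mono d n) f i = d * t n (f (i - n)).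
Proof.
rewrite /= /mul_coef (zsum1 (i0 := n)) /mono_fun ?eqxx // => j /eqP/negPf->.
exact: mul0r.
Qed.

Lemma coef_mul_mono d n (f : laurent) i : mul_lau f (mono d n) i = f (i - n) * t (i - n) d.
Proof.
rewrite /= /mul_coef (zsum1 (i0 := i - n)) /mono_fun.
  by rewrite subKr eqxx.
move=> j neq_j; case: eqP; last by rewrite rmorph0 mulr0.
by move=> ?; case: neq_j; lia.
Qed.

Lemma mul_1lau : left_id (mono 1 0) mul_lau.
Proof. by move=> f; apply: laurentP => i; rewrite mul_mono_coef mul1r subr0 tw0. Qed.
Lemma mul_lau1 : right_id (mono 1 0) mul_lau.
Proof. by move=> f; apply: laurentP => i; rewrite coef_mul_mono subr0 rmorph1 mulr1. Qed.

Lemma mul_lauDl : left_distributive mul_lau +%R.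
Proof.
move=> f g h; apply: laurentP => n.
have [[a fa] [[b gb] [c hc]]] := (ord_geP f, (ord_geP g, ord_geP h)).
have fg : ord_ge (f + g) (Num.min a b).
  by move=> i lt_i; rewrite lcoefD fa ?gb ?addr0 //; lia.
pose R := (`|n| + `|a| + `|b| + `|c|)%N.
rewrite lcoefD /= !(@mul_coef_window _ _ (Num.min a b) c n R) //; try by rewrite /R; lia.
- by rewrite -big_split; apply: eq_bigr => i _; rewrite /= -mulrDl.
- by apply: ord_geW gb; lia.
- by apply: ord_geW fa; lia.
Qed.

Lemma mul_lauDr : right_distributive mul_lau +%R.
Proof.
move=> f g h; apply: laurentP => n.
have [[a fa] [[b gb] [c hc]]] := (ord_geP f, (ord_geP g, ord_geP h)).
have gh : ord_ge (g + h) (Num.min b c).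
  by move=> i lt_i; rewrite lcoefD gb ?hc ?addr0 //; lia.
pose R := (`|n| + `|a| + `|b| + `|c|)%N.
rewrite lcoefD /= !(@mul_coef_window _ _ a (Num.min b c) n R) //; try by rewrite /R; lia.
- by rewrite -big_split; apply: eq_bigr => i _; rewrite /= -mulrDr -rmorphD.
- by apply: ord_geW hc; lia.
- by apply: ord_geW gb; lia.
Qed.

Lemma one_lau_neq0 : mono 1 0 != 0.
Proof.
apply/eqP => /(congr1 (fun f : laurent => f 0)); rewrite coef_mono eqxx.
by apply/eqP; apply: oner_neq0.
Qed.

HB.instance Definition _ := GRing.Zmodule_isNzRing.Build laurent
  mul_lauA mul_1lau mul_lau1 mul_lauDl mul_lauDr one_lau_neq0.

End Laurent.

(** * Division in skew Laurent series *)

Definition division_ring (R : nzRingType) := forall x : R, x != 0 -> exists y, x * y = 1.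

Section DivisionRing.
Variables (R : nzRingType) (divR : division_ring R).
Implicit Types x y : R.

Lemma division_ringV x : x != 0 -> exists2 y, x * y = 1 & y * x = 1.
Proof.
move=> nz_x; have [y xy] := divR nz_x; have [z yz] : exists z, y * z = 1.
  apply: divR; apply: contra_eq_neq xy => ->.
  by rewrite mulr0 eq_sym oner_neq0.
by exists y => //; rewrite -[X in y * X]mulr1 -yz (mulrA x) xy mul1r.
Qed.

Lemma division_mulf_eq0 x y : x * y = 0 -> x = 0 \/ y = 0.
Proof.
move=> xy0; have [->|/division_ringV[z _ zx]] := eqVneq x 0; first by left.
by right; rewrite -[y]mul1r -zx -mulrA xy0 mulr0.
Qed.

End DivisionRing.

Section LaurentTheory.
Variables (D : nzRingType) (t : twist D).
Local Notation L := (laurent t).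
Implicit Types (f g u v : L) (d e : D) (m n N M : int).

Lemma lcoefM f g n : (f * g) n = zsum (fun i => f i * t i (g (n - i))).
Proof. by []. Qed.

Lemma lcoef1 n : (1 : L) n = (n == 0)%:R.
Proof. by rewrite [LHS]coef_mono; case: eqP. Qed.

Lemma lcoef_sum (I : Type) (r : seq I) (F : I -> L) n :
  (\sum_(i <- r) F i) n = \sum_(i <- r) F i n.
Proof. by elim/big_rec2: _ => // i d f _ <-. Qed.

Lemma coef_monoM d n f i : (mono t d n * f) i = d * t n (f (i - n)).
Proof. exact: mul_mono_coef. Qed.

Lemma coef_Mmono d n f i : (f * mono t d n) i = f (i - n) * t (i - n) d.
Proof. exact: coef_mul_mono. Qed.

Lemma monoM d e m n : mono t d m * mono t e n = mono t (d * t m e) (m + n).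
Proof.
apply: laurentP => i; rewrite coef_monoM !coef_mono subr_eq addrC.
by case: eqP; rewrite ?rmorph0 ?mulr0.
Qed.

Definition const d : L := mono t d 0.

Lemma coef_const d n : const d n = if n == 0 then d else 0.
Proof. by []. Qed.

Lemma const_is_zmod_morphism : zmod_morphism const.
Proof.
move=> d e; apply: laurentP => i; rewrite lcoefB !coef_const.
by case: eqP; rewrite ?subr0.
Qed.
HB.instance Definition _ := GRing.isZmodMorphism.Build D L const const_is_zmod_morphism.

Lemma const_is_monoid_morphism : monoid_morphism const.
Proof. by split=> // d e; rewrite /const monoM tw0. Qed.
HB.instance Definition _ := GRing.isMonoidMorphism.Build D L const const_is_monoid_morphism.

Lemma ord_ge1 : ord_ge (1 : L) 0. Proof. exact: mono_ge. Qed.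

Lemma ord_geB f g N : ord_ge f N -> ord_ge g N -> ord_ge (f - g) N.
Proof. by move=> fN gN i ltiN; rewrite lcoefB fN ?gN ?subr0. Qed.

Lemma ord_geM f g M N : ord_ge f M -> ord_ge g N -> ord_ge (f * g) (M + N).
Proof. exact: mul_coef_ge. Qed.

Lemma lcoefM_lead f g M N : ord_ge f M -> ord_ge g N ->
  (f * g) (M + N) = f M * t M (g N).
Proof. exact: mul_coef_lead. Qed.

Lemma ord_geS f N : ord_ge f N -> f N = 0 -> ord_ge f (N + 1).
Proof.
by move=> fN f0 i lt_i; have [->|ne] := eqVneq i N; [|apply: fN; lia].
Qed.

Lemma ord_ge_eq0 f : (forall N, ord_ge f N) -> f = 0.
Proof. by move=> f_ge; apply: laurentP => i; apply: (f_ge (i + 1)); lia. Qed.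

Lemma ordP f : f != 0 -> exists2 N, ord_ge f N & f N != 0.
Proof.
move=> nz_f; have [M fM] := ord_geP f.
have ex_n : exists n : nat, f (M + n%:Z) != 0.
  apply: contrapT => /forallNP f0; move/eqP: nz_f; apply; apply: laurentP => i.
  have [/fM//|leMi] := ltP i M.
  by have /negP/negPn/eqP := f0 (absz (i - M)); rewrite gez0_abs ?subr_ge0 // subrKC.
case: (ex_minnP ex_n) => n fn n_min; exists (M + n%:Z) => // i lt_i.
have [/fM//|leMi] := ltP i M; apply/eqP/negPn/negP => fi.
have /n_min : f (M + (absz (i - M))%:Z) != 0 by rewrite gez0_abs ?subr_ge0 // subrKC.
lia.
Qed.

Lemma ord_ge_expn f N (n : nat) : ord_ge f N -> ord_ge (f ^+ n) (N *+ n).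
Proof.
move=> fN; elim: n => [|n IHn]; first by rewrite expr0 mulr0n; apply: ord_ge1.
by rewrite exprS mulrS; apply: ord_geM.
Qed.

(** The inverse is the sum of the powers of [f]; each of its coefficients only
    depends on finitely many powers, as the n-th power has order at least n. *)
Lemma geometric f : ord_ge f 1 -> exists g, (1 - f) * g = 1.
Proof.
move=> f1.
pose P (n : nat) := \sum_(i < n) f ^+ i.
have P_stable (n N : nat) (i : int) : i < n%:Z -> (n <= N)%N -> P N i = P n i.
  move=> lt_in /subnKC <-; elim: (N - n)%N => [|k IHk]; first by rewrite addn0.
  rewrite addnS /P big_ord_recr lcoefD -/(P _) IHk.
  by rewrite (@ord_ge_expn f 1 (n + k)) ?addr0 //; lia.
have gb : bounded_below (fun i : int => P (absz (i + 1)) i).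
  apply: (@bounded_belowP _ _ 0) => i lt_i0.
  rewrite lcoef_sum big1 // => k _.
  by rewrite (@ord_ge_expn f 1 k) //; lia.
pose g : L := Laurent t gb; exists g.
apply: laurentP => i; pose n := absz (i + 1).
have gP : ord_ge (g - P n) (i + 1).
  move=> k lt_ki; rewrite lcoefB /=; apply/eqP; rewrite subr_eq0; apply/eqP.
  have [k_lt0|k_ge0] := ltP k 0.
    by rewrite !lcoef_sum !big1 // => l _; rewrite (@ord_ge_expn f 1 l) //; lia.
  by apply/esym/P_stable; rewrite /n; lia.
have f0 : ord_ge (1 - f) 0.
  by apply: ord_geB; [apply: ord_ge1 | apply: ord_geW f1].
rewrite -[g](subrK (P n)) mulrDr lcoefD.
rewrite [X in X + _](ord_geM f0 gP) ?add0r; last lia.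
rewrite -opprB mulNr -subrX1 opprB lcoefB.
by rewrite (@ord_ge_expn f 1 n) ?subr0 // /n; lia.
Qed.

(** Multiplying by the inverse of the leading term reduces to a series 1 - m,
    where m has positive order. *)
Lemma laurent_division : division_ring D -> division_ring L.
Proof.
move=> divD f /ordP[N fN] /(division_ringV divD)[e fNe _].
pose g := f * mono t (t (- N) e) (- N).
have g0 : ord_ge (1 - g) 1.
  apply: (@ord_geS _ 0); last rewrite lcoefB lcoef1 eqxx coef_Mmono.
    apply: ord_geB; first exact: ord_ge1.
    by rewrite -(addrN N); apply: ord_geM => //; apply: mono_ge.
  by rewrite sub0r opprK -twD addrN tw0 fNe subrr.
have [h] := geometric g0; rewrite subKr -mulrA => gh.
by exists (mono t (t (- N) e) (- N) * h).
Qed.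

End LaurentTheory.

(** * Centralizers in skew Laurent series *)

Section Valuation.
Variables (D : nzRingType) (t : twist D).
Hypothesis divD : division_ring D.
Local Notation L := (laurent t).
Implicit Types (f g u v : L) (d e : D) (m n N M : int).

(** When the coefficients form a division ring, the order is a valuation. *)
Definition val_at f N := ord_ge f N /\ f N <> 0.

Lemma val_exists f : f <> 0 -> exists N, val_at f N.
Proof. by move=> /eqP/ordP[N fN /eqP nz]; exists N. Qed.

Lemma val_unique f M N : val_at f M -> val_at f N -> M = N.
Proof.
move=> [fM nzM] [fN nzN]; have [/fN//|/fM//|//] := ltgtP M N.
Qed.

Lemma val_neq0 f N : val_at f N -> f <> 0.
Proof. by move=> [_ nz] f0; apply: nz; rewrite f0. Qed.

Lemma tw_neq0 n d : d <> 0 -> t n d <> 0.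
Proof. by move=> nz /(congr1 (t (- n))); rewrite -twD addNr tw0 rmorph0. Qed.

Lemma val_mono d n : d <> 0 -> val_at (mono t d n) n.
Proof. by move=> nz; split; [apply: mono_ge | rewrite coef_mono eqxx]. Qed.

Lemma val1 : val_at 1 0.
Proof. by apply: val_mono; apply/eqP/oner_neq0. Qed.

Lemma valM f g M N : val_at f M -> val_at g N -> val_at (f * g) (M + N).
Proof.
move=> [fM nzf] [gN nzg]; split; first exact: ord_geM.
by rewrite lcoefM_lead // => /(division_mulf_eq0 divD)[]//; apply: tw_neq0.
Qed.

Lemma val_expn f N (n : nat) : val_at f N -> val_at (f ^+ n) (N *+ n).
Proof.
move=> fN; elim: n => [|n IHn]; first exact: val1.
by rewrite exprS mulrS; apply: valM.
Qed.

Lemma valV f g N : f * g = 1 -> val_at f N -> val_at g (- N).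
Proof.
move=> fg1 fN; have /val_exists[M gM] : g <> 0.
  by move=> g0; move: fg1; rewrite g0 mulr0; apply/eqP; rewrite eq_sym oner_neq0.
suff -> : - N = M by [].
by have := valM fN gM; rewrite fg1 => /(val_unique val1)/esym/eqP; rewrite addrC addr_eq0 => /eqP->.
Qed.

End Valuation.

Section Centralizers.
Variables (D : nzRingType) (t : twist D).
Hypotheses (divD : division_ring D) (comD : forall d e : D, d * e = e * d).
Hypothesis fixD : forall n d, n <> 0 -> t n d = d -> forall m, t m d = d.
Local Notation L := (laurent t).
Implicit Types (f g u v : L) (d e : D) (m n N M : int).

Definition twist_fixed d := forall m, t m d = d.

Lemma const_central d f : twist_fixed d -> GRing.comm (const t d) f.
Proof.
move=> td; apply: laurentP => i.
by rewrite coef_monoM coef_Mmono subr0 tw0 td comD.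
Qed.

(** Comparing the leading coefficients in fu = uf and in fv = vf shows that
    the ratio of the leading coefficients of [u] and [v] is fixed by t^n. *)
Lemma comm_same_val f n u v m : val_at f n -> n <> 0 ->
    GRing.comm f u -> GRing.comm f v -> ord_ge u m -> val_at v m ->
  exists2 d, twist_fixed d & ord_ge (u - const t d * v) (m + 1).
Proof.
move=> [fn nzf] n0 fu fv um [vm /eqP nzv].
have lead w : GRing.comm f w -> ord_ge w m -> f n * t n (w m) = w m * t m (f n).
  move=> fw wm; rewrite -lcoefM_lead // -[RHS]lcoefM_lead //.
  by rewrite addrC fw.
have [e ve ev] := division_ringV divD nzv.
exists (u m * e).
  apply: (fixD n0); rewrite rmorphM.
  suff tuv : t n (u m) * v m = u m * t n (v m).
    rewrite -[t n (u m)]mulr1 -ve mulrA tuv -!mulrA; congr (_ * _).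
    by rewrite (comD e) mulrA -rmorphM ve rmorph1 mul1r.
  apply/eqP; rewrite -subr_eq0; apply/eqP.
  have /(division_mulf_eq0 divD)[/nzf//|//] : 
     f n * (t n (u m) * v m - u m * t n (v m)) = 0.
  rewrite mulrBr !mulrA lead // (comD (f n)) -!mulrA lead //.
  by rewrite (comD (v m)) subrr.
apply: ord_geS => [|]; last first.
  by rewrite lcoefB coef_monoM subr0 tw0 -mulrA ev mulr1 subrr.
apply: ord_geB => //; rewrite -[m]add0r; apply: ord_geM => //; exact: mono_ge.
Qed.

(** Let [g] have minimal positive order d in the centralizer of [f]. All orders
    of elements of the centralizer are multiples of d, so [comm_same_val] applied to
    the powers of [g] approximates each of these elements by combinations of powers
    of [g] to any order. The approximants are described as elements of the double
    centralizer of [g]: this is what has to be known of them to make the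
    commutator of two elements have arbitrarily large order, first when one of the elements
    is [g] itself and then in general. *)
Lemma centralizer_val_pos f n : val_at f n -> 0 < n ->
  forall u v, GRing.comm f u -> GRing.comm f v -> GRing.comm u v.
Proof.
move=> fn n_gt0.
have n0 : n <> 0 by lia.
have [g [d [fg gd d_gt0 d_min]]] : exists g (d : int), [/\ GRing.comm f g, val_at g d, 0 < d
    & forall h (e : int), GRing.comm f h -> val_at h e -> 0 < e -> d <= e].
  pose P (k : nat) := `[< exists2 g, GRing.comm f g & val_at g k.+1%:Z >].
  have exP : exists k, P k.
    exists (absz (n - 1)); apply/asboolP; exists f => //.
    by have -> : (absz (n - 1)).+1%:Z = n by lia.
  case: (ex_minnP exP) => k /asboolP[g fg gk] k_min.
  exists g, k.+1%:Z; split=> // h e fh he e_gt0.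
  have /k_min: P (absz (e - 1)); last lia.
  apply/asboolP; exists h => //.
  by have -> : (absz (e - 1)).+1%:Z = e by lia.
have [g' gg' g'g] := division_ringV (laurent_division divD) (introN eqP (val_neq0 gd)).
have fg' : GRing.comm f g'.
  by rewrite /GRing.comm -[f in LHS]mul1r -g'g -mulrA -mulrA (mulrA g) -fg -mulrA gg' mulr1.
(* the double centralizer of g, within the centralizer of f *)
pose cc p := GRing.comm f p /\ forall v, GRing.comm g v -> GRing.comm p v.
have pow (i : int) : exists2 p, cc p & val_at p (i * d).
  case: i => k.
    exists (g ^+ k); last by rewrite mulrC; have := val_expn divD k gd; rewrite -mulr_natr natz.
    split; first exact: commrX.
    by move=> v gv; apply/commr_sym/commrX/commr_sym.
  exists (g' ^+ k.+1); last first.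
    have := val_expn divD k.+1 (valV divD gg' gd).
    by rewrite NegzE mulNr mulNrn -mulr_natr natz mulrC.
  split; first exact: commrX.
  move=> v gv; apply/commr_sym/commrX.
  by rewrite /GRing.comm -[v in LHS]mul1r -g'g -mulrA -mulrA (mulrA g) gv -!mulrA gg' mulr1.
have mult u m : GRing.comm f u -> val_at u m -> exists i, m = i * d.
  move=> fu um; exists (m %/ d)%Z; have [p [fp _] pi] := pow (- (m %/ d)%Z).
  have := valM divD um pi; rewrite mulNr; have := divz_eq m d.
  have := modz_ge0 m (lt0r_neq0 d_gt0); have := ltz_pmod m d_gt0.
  move: (m %% d)%Z => r ltr r_ge0 em.
  have -> : m - (m %/ d)%Z * d = r by rewrite {1}em addrAC subrr add0r.
  have [r0|r_neq0] := eqVneq r 0; first by move=> _; rewrite {1}em r0 addr0.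
  move=> /d_min; have : GRing.comm f (u * p) by apply: commrM.
  by move=> h /(_ h); lia.
have approx (s : nat) : forall u N, GRing.comm f u -> ord_ge u (N - s%:Z) ->
    exists2 p, cc p & ord_ge (u - p) N.
  elim: s => [|s IHs] u N fu uN.
    exists 0; last by rewrite subr0 -(subr0 N).
    by split=> [|v _]; [exact: commr0 | exact/commr_sym/commr0].
  set m := N - s.+1%:Z in uN.
  have em : N - s%:Z = m + 1 by rewrite /m; lia.
  have [um0|/eqP um] := eqVneq (u m) 0.
    by apply: IHs => //; rewrite em; apply: ord_geS.
  have [i mi] := mult u m fu (conj uN um).
  have [p [fp gp]] := pow i; rewrite -mi => pm.
  have [c tc cm] := comm_same_val fn n0 fu fp uN pm.
  have cC := const_central _ tc.
  have fcp : GRing.comm f (const t c * p) by apply: commrM => //; apply/commr_sym.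
  have [r [fr gr] rN] := IHs _ N (commrB fu fcp) (eq_ind_r (ord_ge _) cm em).
  exists (r + const t c * p); last by rewrite opprD addrA addrAC.
  split=> [|v gv]; first exact: commrD.
  apply/commr_sym/commrD; first exact/commr_sym/gr.
  by apply: commrM; apply/commr_sym => //; apply: gp.
have step g1 : (forall p, cc p -> GRing.comm p g1) ->
    forall u, GRing.comm f u -> GRing.comm u g1.
  move=> ccg1 u fu; apply/eqP; rewrite -subr_eq0; apply/eqP; apply: ord_ge_eq0 => N.
  have [[M uM] [M1 gM1]] := (ord_geP u, ord_geP g1).
  have uM' : ord_ge u (N - M1 - (absz (N - M1 - M)%R)%:Z) by apply: ord_geW uM; lia.
  have [p ccp pN] := approx _ u _ fu uM'.
  have -> : u * g1 - g1 * u = (u - p) * g1 - g1 * (u - p).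
    by rewrite mulrBl mulrBr (ccg1 p ccp) opprB addrA subrK.
  apply: ord_geB; last by rewrite -(subrKC M1 N); apply: ord_geM.
  by rewrite -[N](subrK M1); apply: ord_geM.
have gC u : GRing.comm f u -> GRing.comm u g.
  by apply: step => p [_ /(_ g)]; apply.
move=> u v fu fv; apply: (step v) => // p [_ gp]; apply: gp.
exact/commr_sym/gC.
Qed.

(** Up to an inverse or a fixed constant, [f] has positive order, or order 0 with a leading
    coefficient that no t^m with m nonzero fixes. In the latter case the
    centralizer only has elements of order 0, whereas the commutator of two such elements
    has positive order. *)
Theorem centralizer_comm f : ~ (exists2 d, twist_fixed d & f = const t d) ->
  forall u v, GRing.comm f u -> GRing.comm f v -> GRing.comm u v.
Proof.
have neq0_case g n : val_at g n -> n <> 0 ->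
    forall u v, GRing.comm g u -> GRing.comm g v -> GRing.comm u v.
  move=> gn n0; have [/(centralizer_val_pos gn)//|n_lt0|//] := ltgtP 0 n; last by move/esym.
  have [g' gg' g'g] := division_ringV (laurent_division divD) (introN eqP (val_neq0 gn)).
  have g'C w : GRing.comm g w -> GRing.comm g' w.
    by move=> gw; rewrite /GRing.comm -[w in LHS]mulr1 -gg' (mulrA w) -gw !mulrA g'g mul1r.
  move=> u v /g'C gu /g'C gv; apply: (centralizer_val_pos (valV divD gg' gn)) => //.
  by rewrite oppr_gt0.
move=> f_nfix.
have nz_f : f <> 0.
  move=> f0; apply: f_nfix; exists 0; last by rewrite f0 rmorph0.
  by move=> m; rewrite rmorph0.
have [n fn] := val_exists nz_f.
have [n_0|/eqP n0] := eqVneq n 0; last exact: neq0_case fn n0.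
rewrite {n}n_0 in fn.
have [tf0|ntf0] := pselect (twist_fixed (f 0)).
  have /val_exists[m gm] : f - const t (f 0) <> 0.
    by move=> /eqP; rewrite subr_eq0 => /eqP f_eq; apply: f_nfix; exists (f 0).
  have m0 : m <> 0 by move=> em; case: gm; rewrite em lcoefB coef_const eqxx subrr.
  move=> u v fu fv; apply: (neq0_case _ _ gm m0);
  by apply/commr_sym/commrB; apply/commr_sym => //; apply: const_central.
have val0 u : GRing.comm f u -> u <> 0 -> val_at u 0.
  move=> fu /val_exists[m um]; have [m_0|/eqP m0] := eqVneq m 0; first by rewrite -{1}m_0.
  case: ntf0; apply: (fixD m0).
  have : (f * u) (0 + m) = (u * f) (m + 0) by rewrite fu addrC.
  case: fn um => f0 _ [um /eqP nzu]; rewrite !lcoefM_lead // tw0 comD.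
  have [e _ eu] := division_ringV divD nzu.
  by move=> /(congr1 ( *%R e)); rewrite !mulrA eu !mul1r.
move=> u v fu fv; apply/eqP; rewrite -subr_eq0; apply/eqP; apply: contrapT => nz.
have [u0|nzu] := pselect (u = 0); first by case: nz; rewrite u0 mul0r mulr0 subrr.
have [v0|nzv] := pselect (v = 0); first by case: nz; rewrite v0 mul0r mulr0 subrr.
have /val0/(_ nz)[_] : GRing.comm f (u * v - v * u) by apply: commrB; apply: commrM.
have [[u0 _] [v0 _]] := (val0 u fu nzu, val0 v fv nzv).
by case; rewrite -[0]addr0 lcoefB !lcoefM_lead // !tw0 comD subrr.
Qed.

Section Trace.
Variables (V : nmodType) (eps : {additive D -> V}).
Hypothesis eps_tw : forall n d, eps (t n d) = eps d.

(** The terms with indices i and -i of the two products correspond, up to a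
    power of the twist, which [eps] does not see. *)
Lemma trace_comm u v : eps ((u * v) 0) = eps ((v * u) 0).
Proof.
have [[M uM] [N vN]] := (ord_geP u, ord_geP v).
pose R := (`|M| + `|N|)%N.
rewrite !lcoefM -[zsum (fun i => v i * _)](@zsum_reflect _ _ 0 (R + R)%N); last first.
  by move=> i /(mul_coef_supp vN uM); rewrite /R; lia.
rewrite !(zsum_window (n := (R + R)%N)).
- rewrite !raddf_sum; apply: eq_bigr => i _; rewrite subKr !sub0r.
  by rewrite -(eps_tw i (v _ * _)) rmorphM -twD addrN tw0 comD.
- by move=> i /(mul_coef_supp vN uM); rewrite /R; lia.
- by move=> i /(mul_coef_supp uM vN); rewrite /R; lia.
Qed.

End Trace.
End Centralizers.

(** * Laurent series over a field and their dilations *)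

Section TrivialTwist.
Variable k : fieldType.

Definition trivial_twist : twist k :=
  Twist (tw := fun=> idfun) (fun=> erefl) (fun _ _ _ => erefl).
Local Notation D := (laurent trivial_twist).

Lemma field_division : division_ring k.
Proof. by move=> x nz; exists x^-1; rewrite divff. Qed.

Lemma laurent_field_comm (f g : D) : f * g = g * f.
Proof.
apply: laurentP => n; have [[M fM] [N gN]] := (ord_geP f, ord_geP g).
pose R := (`|M| + `|N| + `|n|)%N.
rewrite !lcoefM -(@zsum_reflect _ _ n (R + R)%N); last first.
  by move=> i /(@mul_coef_supp _ trivial_twist _ _ _ _ _ fM gN); rewrite /R; lia.
by congr zsum; apply: funext => i /=; rewrite subKr mulrC.
Qed.

Variables (s : k) (s_neq0 : s != 0).

Lemma dilate_bounded (n : int) (f : D) : bounded_below (fun i => s ^ (n * i) * f i).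
Proof.
have [N fN] := ord_geP f; apply: (@bounded_belowP _ _ N) => i /fN ->.
by rewrite mulr0.
Qed.

(** The substitution of s^n h for h. *)
Definition dilate n f : D := Laurent trivial_twist (dilate_bounded n f).

Lemma coef_dilate n f i : dilate n f i = s ^ (n * i) * f i. Proof. by []. Qed.

Lemma dilate_is_zmod_morphism n : zmod_morphism (dilate n).
Proof. by move=> f g; apply: laurentP => i; rewrite lcoefB !coef_dilate -mulrBr. Qed.
HB.instance Definition _ n :=
  GRing.isZmodMorphism.Build D D (dilate n) (dilate_is_zmod_morphism n).

Lemma dilate_is_monoid_morphism n : monoid_morphism (dilate n).
Proof.
split=> [|f g]; apply: laurentP => i; rewrite ?coef_dilate.
  by rewrite lcoef1; case: eqP => [->|]; rewrite ?mulr0 ?mulr1 // expr0z.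
have [[M fM] [N gN]] := (ord_geP f, ord_geP g).
pose R := (`|M| + `|N| + `|i|)%N.
rewrite !lcoefM !(zsum_window (n := (R + R)%N)); last 2 first.
- move=> j nz.
  have /(@mul_coef_supp _ trivial_twist _ _ _ _ _ fM gN) : f j * g (i - j) <> 0.
    by move=> fg; apply: nz; rewrite !coef_dilate /= mulrACA fg mulr0.
  by rewrite /R; lia.
- by move=> j /(@mul_coef_supp _ trivial_twist _ _ _ _ _ fM gN); rewrite /R; lia.
rewrite mulr_sumr; apply: eq_bigr => j _; rewrite /= mulrACA -expfzDr //.
by rewrite -mulrDr subrKC.
Qed.
HB.instance Definition _ n :=
  GRing.isMonoidMorphism.Build D D (dilate n) (dilate_is_monoid_morphism n).

Lemma dilate0 f : dilate 0 f = f.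
Proof. by apply: laurentP => i; rewrite coef_dilate mul0r mul1r. Qed.

Lemma dilateD m n f : dilate (m + n) f = dilate m (dilate n f).
Proof. by apply: laurentP => i; rewrite !coef_dilate mulrDl expfzDr // mulrA. Qed.

Definition dilation_twist : twist D := Twist dilate0 dilateD.

Hypothesis s_nroot : forall n : nat, (0 < n)%N -> s ^+ n != 1.

Lemma exprz_neq1 (n : int) : n <> 0 -> s ^ n != 1.
Proof.
case: n => [[|n] // _|n _]; first exact: s_nroot.
by rewrite NegzE -invr_expz invr_eq1; apply: s_nroot.
Qed.

(** The coefficient of h^i is multiplied by s^(n i), which is 1 only for i = 0. *)
Lemma dilate_fixed_const n f : n <> 0 -> dilate n f = f -> f = const _ (f 0).
Proof.
move=> n0 /(congr1 (fun f : D => (f : int -> k))) ff; apply: laurentP => i.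
rewrite coef_const; case: eqP => [->//|i0].
apply/eqP; have := congr1 (@^~ i) ff; rewrite coef_dilate -[RHS]mul1r => /eqP.
rewrite -subr_eq0 -mulrBl mulf_eq0 subr_eq0 => /orP[|//].
by rewrite (negPf (exprz_neq1 _)) // => /eqP; rewrite mulf_eq0 => /orP[]/eqP.
Qed.

Lemma dilate_const n d : dilate n (const _ d) = const _ d.
Proof.
apply: laurentP => i; rewrite coef_dilate coef_const.
by case: eqP => [->|_]; [rewrite mulr0 mul1r | rewrite mulr0].
Qed.

Lemma dilate_fixed n f : n <> 0 -> dilate n f = f -> forall m, dilate m f = f.
Proof. by move=> n0 /(dilate_fixed_const n0)-> m; rewrite dilate_const. Qed.

End TrivialTwist.

(** * The quantum torus *)

Section QuantumTorus.
Variables (k : fieldType) (s c : k) (s_neq0 : s != 0) (s2_neq1 : s ^+ 2 != 1).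
Local Notation D := (laurent (trivial_twist k)).
Local Notation L := (laurent (dilation_twist s_neq0)).
Local Notation monoD := (mono (trivial_twist k)).
Local Notation monoL := (mono (dilation_twist s_neq0)).
Local Notation scal d := (const (dilation_twist s_neq0) (const (trivial_twist k) d)).

(** The image of X. The ring [L] of series in x over k((h)), where x h = s h x,
    contains the quantum torus generated by x and h. *)
Definition qt_x : L := monoL 1 1.
Definition qt_h : L := const _ (monoD 1 1).
Definition qt_hi : L := const _ (monoD 1 (- 1)).
(** The series c + g(h), to be the image of YX when c is the image of the
    Casimir element. *)
Definition qt_yx : D := monoD c 0 + (monoD ((s - s^-1)^-1 * (s ^+ 2 - 1)^-1) 2
                                     - monoD ((s - s^-1)^-1 * (s ^- 2 - 1)^-1) (- 2)).
Definition qt_y : L := monoL qt_yx (- 1).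

Lemma scal_central d f : GRing.comm (scal d) f.
Proof. by apply: const_central; [exact: laurent_field_comm | move=> m; apply: dilate_const]. Qed.

Lemma qt_hhi : qt_h * qt_hi = 1.
Proof. by rewrite -rmorphM monoM mulr1 addrN. Qed.

Lemma qt_hih : qt_hi * qt_h = 1.
Proof. by rewrite -rmorphM monoM mulr1 addNr. Qed.

Lemma dilate_monoD n d m : dilate s n (monoD d m) = monoD (s ^ (n * m) * d) m.
Proof.
apply: laurentP => i; rewrite coef_dilate !coef_mono.
by case: eqP => [->|]; rewrite ?mulr0.
Qed.

Lemma qt_xh : qt_x * qt_h = scal s * (qt_h * qt_x).
Proof.
rewrite /qt_x /qt_h /const !monoM !tw0 /= !add0r addr0 mul1r mulr1.
by rewrite dilate_monoD monoM /= !mulr1 add0r.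
Qed.

Lemma qt_yh : qt_y * qt_h = scal s^-1 * (qt_h * qt_y).
Proof.
rewrite /qt_y /qt_h /const !monoM !tw0 /= !add0r addr0; congr mono.
by rewrite laurent_field_comm dilate_monoD !mulr1 mulrA monoM /= mulr1 add0r.
Qed.

Lemma qt_yx_eq : qt_y * qt_x = const _ qt_yx.
Proof. by rewrite monoM rmorph1 mulr1 addNr. Qed.

Lemma qt_xy_eq : qt_x * qt_y = const _ (dilate s 1 qt_yx).
Proof. by rewrite monoM mul1r addrN. Qed.

Lemma scal_h2 d : scal d * qt_h ^+ 2 = const _ (monoD d 2).
Proof. by rewrite expr2 -!rmorphM !monoM /= !mulr1. Qed.

Lemma scal_hi2 d : scal d * qt_hi ^+ 2 = const _ (monoD d (- 2)).
Proof. by rewrite expr2 -!rmorphM !monoM /= !mulr1. Qed.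

Lemma coef_qt_yx i : qt_yx i = (if i == 0 then c else 0)
  + ((if i == 2 then (s - s^-1)^-1 * (s ^+ 2 - 1)^-1 else 0)
     - (if i == - 2 then (s - s^-1)^-1 * (s ^- 2 - 1)^-1 else 0)).
Proof. by []. Qed.

(** With g the non-constant part of [qt_yx], the left-hand side is g(sh) - g(h).
    The denominators s^2 - 1 and s^-2 - 1 of g are the factors by which this difference
    operator scales h^2 and h^-2. *)
Lemma qt_commutator :
  qt_x * qt_y - qt_y * qt_x = scal (s - s^-1)^-1 * (qt_h ^+ 2 - qt_hi ^+ 2).
Proof.
have s2 : s ^+ 2 - 1 != 0 by rewrite subr_eq0.
have s3 : s ^- 2 - 1 != 0 by rewrite subr_eq0 invr_eq1.
rewrite qt_yx_eq qt_xy_eq mulrBr scal_h2 scal_hi2 -!rmorphB; congr const.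
apply: laurentP => i; rewrite !lcoefB coef_dilate mul1r coef_qt_yx !coef_mono.
(* the difference operator multiplies the coefficient of h^(2) or h^(-2) by x - 1 *)
have key (x A : k) : x - 1 != 0 -> x * (A / (x - 1)) - A / (x - 1) = A.
  by move=> x1; rewrite -[X in _ - X]mul1r -mulrBl mulrCA divff ?mulr1.
have e2 : s ^ (2 : int) = s ^+ 2 by [].
have em2 : s ^ (- 2 : int) = s ^- 2 by rewrite -exprnN.
case: eqP => [->|_]; first by rewrite /= expr0z; ring.
case: eqP => [->|_]; first by rewrite /= e2 !add0r !subr0 key.
case: eqP => [->|_]; last by ring.
by rewrite em2 /= !add0r mulrN opprK addrC -opprB key.
Qed.

Lemma qt_casimir : qt_y * qt_x
    - scal (s - s^-1)^-1 * (scal (s ^+ 2 - 1)^-1 * qt_h ^+ 2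
                             - scal (s ^- 2 - 1)^-1 * qt_hi ^+ 2) = scal c.
Proof.
have scalA d e f : scal d * (scal e * f) = scal (d * e) * f.
  by rewrite (rmorphM (const _)) (rmorphM (const (dilation_twist s_neq0))) mulrA.
rewrite mulrBr [X in _ - (X - _)]scalA [X in _ - (_ - X)]scalA.
rewrite [X in _ - (X - _)]scal_h2 [X in _ - (_ - X)]scal_hi2 qt_yx_eq.
have -> : const (dilation_twist s_neq0) qt_yx = scal c +
  (const _ (monoD ((s - s^-1)^-1 * (s ^+ 2 - 1)^-1) 2)
   - const _ (monoD ((s - s^-1)^-1 * (s ^- 2 - 1)^-1) (- 2))).
  by rewrite -[const _ _ - const _ _]rmorphB -rmorphD.
by rewrite addrK.
Qed.

Lemma qt_hX n : qt_h ^+ n = const _ (monoD 1 n).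
Proof.
elim: n => [|n IHn]; first by [].
by rewrite exprS IHn -rmorphM monoM mulr1 -intS.
Qed.

Lemma qt_xX n : qt_x ^+ n = monoL 1 n.
Proof.
elim: n => [//|n IHn].
by rewrite exprS IHn monoM rmorph1 mulr1 -intS.
Qed.

Lemma qt_monomial d m n : scal d * qt_h ^+ m * qt_x ^+ n = monoL (monoD d m) n.
Proof. by rewrite qt_hX qt_xX -rmorphM !monoM !rmorph1 !mulr1 !add0r. Qed.

(** The pair consists of the exponent of h and of the exponent of x. *)
Definition qt_coord (mn : nat * nat) (u : L) : k := u (mn.2 : int) (mn.1 : int).

Lemma qt_coord0 mn : qt_coord mn 0 = 0. Proof. by []. Qed.
Lemma qt_coordD mn u v : qt_coord mn (u + v) = qt_coord mn u + qt_coord mn v.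
Proof. by []. Qed.

Lemma qt_coordZ mn d u : qt_coord mn (scal d * u) = d * qt_coord mn u.
Proof. by rewrite /qt_coord coef_monoM subr0 tw0 coef_monoM subr0. Qed.

Lemma qt_coord_monomial mn d mn' :
  qt_coord mn (scal d * qt_h ^+ mn'.1 * qt_x ^+ mn'.2) = if mn' == mn then d else 0.
Proof.
case: mn mn' => [m n] [m' n']; rewrite qt_monomial /qt_coord !coef_mono xpair_eqE /=.
rewrite !eqz_nat (eq_sym m') (eq_sym n').
by case: (n == n'); rewrite ?andbF // coef_mono eqz_nat andbT.
Qed.

Hypothesis s_nroot : forall n : nat, (0 < n)%N -> s ^+ n != 1.

Lemma qt_division : division_ring L.
Proof. exact/laurent_division/laurent_division/field_division. Qed.

Definition const_term (f : D) : k := f 0.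
Lemma const_term_is_zmod_morphism : zmod_morphism const_term.
Proof. by []. Qed.
HB.instance Definition _ :=
  GRing.isZmodMorphism.Build D k const_term const_term_is_zmod_morphism.

Lemma qt_no_scalar_commutator u v d : u * v - v * u = scal d -> d = 0.
Proof.
move=> uv; transitivity (const_term (scal d 0)); first by [].
rewrite -uv lcoefB raddfB /=.
rewrite (@trace_comm _ _ (@laurent_field_comm k) _ const_term) ?subrr // => n f.
by rewrite /const_term /= mulr0 mul1r.
Qed.

Lemma qt_centralizer f : (exists d, f = scal d) \/
  (forall u v, GRing.comm f u -> GRing.comm f v -> GRing.comm u v).
Proof.
have [[g tg ->]|nf] := pselect (exists2 g, twist_fixed (dilation_twist s_neq0) g
    & f = const _ g).
  left; exists (g 0); congr const.
  exact: (dilate_fixed_const s_nroot (n := 1) _ (tg 1)).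
right; apply: centralizer_comm nf.
- exact/laurent_division/field_division.
- exact: laurent_field_comm.
- by move=> n g n0; apply: dilate_fixed.
Qed.

End QuantumTorus.

(** * Presentation of U_q sl(2) by generators and relations *)

Section FreeWords.
Variables (K : fieldType) (I : choiceType).
Local Notation FA := (malg (fmonom I) K).

Lemma word_nil : mkmalgU (FMonom [::]) 1 = 1 :> FA.
Proof. by rewrite -[FMonom [::]](fmoneE I). Qed.

Lemma word_cons i (s : seq I) :
  mkmalgU (FMonom (i :: s)) 1 = mkmalgU (fmu i) 1 * mkmalgU (FMonom s) 1 :> FA.
Proof.
rewrite malgM_def fgmulUU mulr1; congr mkmalgU.
by apply/eqP; rewrite fmP fmM fmU.
Qed.

Lemma malg_sum (g : FA) : exists (s : seq (fmonom I)) (c : fmonom I -> K),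
  g = \sum_(m <- s) c m *: mkmalgU m 1.
Proof.
exists (finmap.enum_fset (msupp g)), (fun m => mcoeff m g).
rewrite {1}(monalgE g); apply: eq_bigr => m _; apply/malgP => m'.
by rewrite mcoeffZ [in LHS]mcoeffU mcoeffU1 mulr_natr.
Qed.

End FreeWords.

Section Projection.
Variables (K : fieldType) (q : K).
Implicit Types (u v : free_alg K 'I_4).

(** The projection [ideal_proj], given the type of the algebra [Uqsl2] so that
    its compatibility with the operations of that algebra can be stated. *)
Definition uq_proj u : Uqsl2 q := ideal_proj (uq_relations q) u.

Lemma uq_projB u v : uq_proj (u - v) = uq_proj u - uq_proj v.
Proof. exact: ideal_projB. Qed.
Lemma uq_projM u v : uq_proj (u * v) = uq_proj u * uq_proj v.
Proof. exact: ideal_projM. Qed.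
Lemma uq_projZ c u : uq_proj (c *: u) = c *: uq_proj u.
Proof. exact: ideal_projZ. Qed.
Lemma uq_proj1 : uq_proj 1 = 1.
Proof. by []. Qed.
Lemma uq_projK (w : Uqsl2 q) : uq_proj (repr w) = w.
Proof. exact: ideal_reprK. Qed.

Lemma uq_rel r : uq_relations q r -> uq_proj r = 0.
Proof.
move=> rr; apply/eqP; rewrite -[0](subrr (1 : Uqsl2 q)) -uq_proj1 -uq_projB subrr.
rewrite ideal_projP subr0; apply/asboolP; exists [:: (1, r, 1)].
  by move=> t; rewrite inE => /eqP->.
by rewrite big_seq1 mul1r mulr1.
Qed.

End Projection.

Section UniversalProperty.
Variables (K : fieldType) (q : K) (L : nzRingType) (sc : {rmorphism K -> L}).
Variables x y h hi : L.
Local Notation FA := (free_alg K 'I_4).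

Definition gen_image (i : 'I_4) : L := [:: x; y; h; hi]`_i.
Definition word_image (m : fmonom 'I_4) : L := \prod_(i <- fmonom_val m) gen_image i.

Lemma word_imageP : mmorphism word_image.
Proof.
split=> [m n|]; rewrite /word_image.
  by rewrite fmM big_cat.
by rewrite fm1 big_nil.
Qed.
HB.instance Definition _ := monalg.isMultiplicative.Build _ _ word_image word_imageP.

Hypothesis sc_central : forall c u, sc c * u = u * sc c.
Hypotheses (xh : x * h = sc q * (h * x)) (yh : y * h = sc q^-1 * (h * y))
  (xy : x * y - y * x = sc (uq_h q)^-1 * (h ^+ 2 - hi ^+ 2))
  (hhi : h * hi = 1) (hih : hi * h = 1).

Definition free_eval : FA -> L := mmap sc word_image.

Lemma free_evalB : {morph free_eval : u v / u - v}.
Proof. exact: mmapB. Qed.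
Lemma free_evalD : {morph free_eval : u v / u + v}.
Proof. exact: mmapD. Qed.
Lemma free_eval0 : free_eval 0 = 0.
Proof. exact: mmap0. Qed.
Lemma free_evalZ c u : free_eval (c *: u) = sc c * free_eval u.
Proof. exact: mmapZ. Qed.
Lemma free_evalM : {morph free_eval : u v / u * v}.
Proof.
by case: (commr_mmap_is_multiplicative (f := sc) (h := word_image)) => // g m m';
  apply: sc_central.
Qed.
Lemma free_eval1 : free_eval 1 = 1.
Proof. exact: mmap1. Qed.

Lemma free_eval_gen i : free_eval (free_gen K i) = gen_image i.
Proof. by rewrite [LHS]mmapU /= rmorph1 mul1r /word_image fmU big_seq1. Qed.

Lemma eval_relations (A : algType K) (e : A -> L) (X Y H Hi r : A) :
    {morph e : u v / u - v} -> (forall c u, e (c *: u) = sc c * e u) ->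
    {morph e : u v / u * v} -> e 1 = 1 ->
    e X = x -> e Y = y -> e H = h -> e Hi = hi ->
    [\/ r = X * H - q *: (H * X), r = Y * H - q^-1 *: (H * Y),
        r = (X * Y - Y * X) - (uq_h q)^-1 *: (H ^+ 2 - Hi ^+ 2) |
        r = H * Hi - 1 \/ r = Hi * H - 1] -> e r = 0.
Proof.
move=> eB eZ eM e1 eX eY eH eHi [->|->|->|[]->]; rewrite eB.
- by rewrite eZ !eM eX eH xh subrr.
- by rewrite eZ !eM eY eH yh subrr.
- by rewrite eZ !eB !expr2 !eM eX eY eH eHi xy !expr2 subrr.
- by rewrite eM e1 eH eHi hhi subrr.
- by rewrite eM e1 eH eHi hih subrr.
Qed.

Lemma free_eval_relations r : uq_relations q r -> free_eval r = 0.
Proof.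
apply: (@eval_relations FA free_eval (genX K) (genY K) (genH K) (genHi K) r
    free_evalB free_evalZ free_evalM free_eval1).
- exact: (free_eval_gen (@Ordinal 4 0 isT)).
- exact: (free_eval_gen (@Ordinal 4 1 isT)).
- exact: (free_eval_gen (@Ordinal 4 2 isT)).
- exact: (free_eval_gen (@Ordinal 4 3 isT)).
Qed.

Lemma free_eval_ideal u : u \in ideal_pred (uq_relations q) -> free_eval u = 0.
Proof.
move=> /asboolP[s Ss ->]; elim: s Ss => [|t s IHs] Ss.
  by rewrite big_nil free_eval0.
rewrite big_cons free_evalD IHs; last by move=> v vs; apply: Ss; rewrite inE vs orbT.
by rewrite !free_evalM (free_eval_relations (Ss t _)) ?mulr0 ?mul0r ?addr0 // inE eqxx.
Qed.

Definition uq_eval (u : Uqsl2 q) : L := free_eval (repr u).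

Lemma uq_eval_proj u : uq_eval (uq_proj q u) = free_eval u.
Proof.
apply/eqP; rewrite -subr_eq0 -free_evalB; apply/eqP/free_eval_ideal.
exact: ideal_projK.
Qed.

Lemma uq_eval_is_zmod_morphism : zmod_morphism uq_eval.
Proof.
move=> u v; rewrite -{1}[u]uq_projK -{1}[v]uq_projK -uq_projB.
by rewrite uq_eval_proj free_evalB.
Qed.
HB.instance Definition _ :=
  GRing.isZmodMorphism.Build (Uqsl2 q) L uq_eval uq_eval_is_zmod_morphism.

Lemma uq_eval_is_monoid_morphism : monoid_morphism uq_eval.
Proof.
split=> [|u v]; first by rewrite -uq_proj1 uq_eval_proj free_eval1.
rewrite -{1}[u]uq_projK -{1}[v]uq_projK -uq_projM.
by rewrite uq_eval_proj free_evalM.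
Qed.
HB.instance Definition _ :=
  GRing.isMonoidMorphism.Build (Uqsl2 q) L uq_eval uq_eval_is_monoid_morphism.

Lemma uq_universal : exists th : {rmorphism Uqsl2 q -> L},
  [/\ forall c u, th (c *: u) = sc c * th u,
      th (uqX q) = x, th (uqY q) = y, th (uqH q) = h & th (uqHi q) = hi].
Proof.
exists uq_eval; split; last 4 first.
- exact: etrans (uq_eval_proj _) (free_eval_gen _).
- exact: etrans (uq_eval_proj _) (free_eval_gen _).
- exact: etrans (uq_eval_proj _) (free_eval_gen _).
- exact: etrans (uq_eval_proj _) (free_eval_gen _).
by move=> c u; rewrite -{1}[u]uq_projK -uq_projZ [LHS]uq_eval_proj free_evalZ.
Qed.

End UniversalProperty.

Section Generators.
Variables (K : fieldType) (q : K).
Local Notation U := (Uqsl2 q).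
Local Notation X := (uqX q).
Local Notation Y := (uqY q).
Local Notation H := (uqH q).
Local Notation Hi := (uqHi q).
Local Notation h0 := (uq_h q).

Lemma relations_hold (A B : algType K) (e : A -> B) (x y h hi : A) :
    {morph e : u v / u - v} -> (forall c u, e (c *: u) = c *: e u) ->
    {morph e : u v / u * v} -> e 1 = 1 ->
    (forall r, [\/ r = x * h - q *: (h * x), r = y * h - q^-1 *: (h * y),
        r = (x * y - y * x) - h0^-1 *: (h ^+ 2 - hi ^+ 2) |
        r = h * hi - 1 \/ r = hi * h - 1] -> e r = 0) ->
  [/\ e x * e h = q *: (e h * e x), e y * e h = q^-1 *: (e h * e y),
      e x * e y = e y * e x + h0^-1 *: (e h ^+ 2 - e hi ^+ 2),
      e h * e hi = 1 & e hi * e h = 1].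
Proof.
move=> eB eZ eM e1 er; split; apply/eqP; rewrite -subr_eq0.
- by rewrite -!eM -eZ -eB er //; constructor 1.
- by rewrite -!eM -eZ -eB er //; constructor 2.
- by rewrite opprD addrA !expr2 -!eM -!eB -eZ -eB er //; constructor 3; rewrite !expr2.
- by rewrite -!eM -e1 -!eB er //; constructor 4; left.
- by rewrite -!eM -e1 -!eB er //; constructor 4; right.
Qed.

Lemma uq_relations_hold : [/\ X * H = q *: (H * X), Y * H = q^-1 *: (H * Y),
  X * Y = Y * X + h0^-1 *: (H ^+ 2 - Hi ^+ 2), H * Hi = 1 & Hi * H = 1].
Proof.
exact: (@relations_hold (free_alg K 'I_4) U (uq_proj q) (genX K) (genY K) (genH K)
  (genHi K) (@uq_projB K q) (@uq_projZ K q) (@uq_projM K q) (uq_proj1 q)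
  (@uq_rel K q)).
Qed.

Lemma ord4P (i : 'I_4) : [\/ i = @Ordinal 4 0 isT, i = @Ordinal 4 1 isT,
  i = @Ordinal 4 2 isT | i = @Ordinal 4 3 isT].
Proof.
by case: i => [[|[|[|[|i]]]] lt_i]; last by [];
  [constructor 1|constructor 2|constructor 3|constructor 4]; apply: val_inj.
Qed.

(** Induction on words in the generators, which span the algebra. *)
Lemma uq_ind (T : U -> Prop) :
    T 1 -> (forall u v, T u -> T v -> T (u + v)) -> (forall c u, T u -> T (c *: u)) ->
    (forall u, T u -> [/\ T (X * u), T (Y * u), T (H * u) & T (Hi * u)]) ->
  forall u, T u.
Proof.
move=> T1 TD TZ TM u; rewrite -(uq_projK u); move: (repr u) => {}u.
have TF (s : seq 'I_4) : T (uq_proj q (mkmalgU (FMonom s) 1)).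
  elim: s => [|i s IHs]; first by rewrite word_nil.
  have -> : uq_proj q (mkmalgU (FMonom (i :: s)) 1)
      = uq_proj q (free_gen K i) * uq_proj q (mkmalgU (FMonom s) 1).
    by rewrite word_cons; apply: uq_projM.
  have [TX TY TH THi] := TM _ IHs.
  by have [->|->|->|->] := ord4P i; [exact: TX|exact: TY|exact: TH|exact: THi].
have [s [c ->]] := malg_sum u; elim: s => [|m s IHs].
  rewrite big_nil; have -> : uq_proj q 0 = 0 *: 1.
    by rewrite scale0r -[0 in LHS](subrr 0) uq_projB subrr.
  exact: TZ.
have uq_projD (v w : free_alg K 'I_4) : uq_proj q (v + w) = uq_proj q v + uq_proj q w.
  exact: ideal_projD.
rewrite big_cons [uq_proj q _]uq_projD; apply: TD => //.
have -> : uq_proj q (c m *: mkmalgU m 1) = c m *: uq_proj q (mkmalgU m 1).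
  exact: uq_projZ.
by apply: TZ; case: m.
Qed.

End Generators.

(** * Normal forms and injectivity *)

Section NormalForms.
Variables (K : fieldType) (A : algType K) (q d a b : K) (X Y H Hi : A).
Hypothesis q_neq0 : q != 0.
Hypotheses (XH : X * H = q *: (H * X)) (YH : Y * H = q^-1 *: (H * Y))
  (XY : X * Y = Y * X + d *: (H ^+ 2 - Hi ^+ 2)) (HHi : H * Hi = 1) (HiH : Hi * H = 1).
Hypotheses (aE : q ^+ 2 * a - a = 1) (bE : q ^- 2 * b - b = 1).

(** The Casimir element, for relations with unspecified coefficients. *)
Definition cas : A := Y * X - d *: (a *: H ^+ 2 - b *: Hi ^+ 2).
Local Notation C := cas.

Lemma q_commX u (c : K) n : u * H = c *: (H * u) -> u * H ^+ n = c ^+ n *: (H ^+ n * u).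
Proof.
move=> uH; elim: n => [|n IHn]; first by rewrite !expr0 scale1r mulr1 mul1r.
by rewrite !exprS mulrA uH -scalerAl -(mulrA H u) IHn -scalerAr scalerA mulrA.
Qed.

Lemma q_commVX u (c : K) n : c != 0 -> u * H = c *: (H * u) ->
  u * Hi ^+ n = c ^- n *: (Hi ^+ n * u).
Proof.
move=> c0 uH; have uHi : u * Hi = c^-1 *: (Hi * u).
  apply: (scalerI c0); rewrite scalerA divff // scale1r.
  rewrite -[RHS]mulr1 -HHi mulrA -(mulrA Hi u) uH -scalerAr -scalerAl.
  by rewrite !mulrA HiH mul1r.
elim: n => [|n IHn]; first by rewrite !expr0 invr1 scale1r mulr1 mul1r.
by rewrite !exprS mulrA uHi -scalerAl -(mulrA Hi u) IHn -scalerAr scalerA invfM mulrA.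
Qed.

Lemma cas_commH : GRing.comm C H.
Proof.
have YXH : GRing.comm (Y * X) H.
  by rewrite /GRing.comm -(mulrA Y) XH -scalerAr (mulrA Y) YH -scalerAl scalerA divff // scale1r mulrA.
apply/commr_sym/commrB; first exact: commr_sym.
have HHiC : GRing.comm H Hi by rewrite /GRing.comm HHi HiH.
by rewrite /GRing.comm -scalerAr -scalerAl mulrBr mulrBl -!scalerAr -!scalerAl
   -(commrX 2 HHiC) -exprS -exprSr.
Qed.

Local Notation g := (d *: (a *: H ^+ 2 - b *: Hi ^+ 2)).
Local Notation g' := (d *: (q ^+ 2 * a *: H ^+ 2 - q ^- 2 * b *: Hi ^+ 2)).

(** The elements [g] and [g'] are g(H) and g(qH); hence X g(H) = g(qH) X, and the
    identity says that the commutator of X and Y makes YX - g(H) commute with X and Y. *)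
Lemma cas_shift : g' = g + d *: (H ^+ 2 - Hi ^+ 2).
Proof.
rewrite -scalerDr; congr (_ *: _).
have -> : q ^+ 2 * a = a + 1 by rewrite -aE addrC subrK.
have -> : q ^- 2 * b = b + 1 by rewrite -bE addrC subrK.
by rewrite !scalerDl !scale1r opprD addrACA.
Qed.

Lemma cas_commX : GRing.comm C X.
Proof.
have Xg : X * g = g' * X.
  rewrite -scalerAr -scalerAl mulrBr mulrBl -!scalerAr -!scalerAl.
  by rewrite (q_commX 2 XH) (q_commVX 2 q_neq0 XH) !scalerA (mulrC a) (mulrC b).
rewrite /GRing.comm /cas mulrBr Xg cas_shift mulrA XY mulrBl !mulrDl opprD.
by rewrite [- (g * X) - _]addrC addrA addrK.
Qed.

Lemma cas_commY : GRing.comm C Y.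
Proof.
have q'0 : q^-1 != 0 by rewrite invr_eq0.
have gY : g * Y = Y * g'.
  rewrite -scalerAr -scalerAl mulrBr mulrBl -!scalerAr -!scalerAl.
  rewrite (q_commX 2 YH) (q_commVX 2 q'0 YH) !scalerA !exprVn invrK.
  by rewrite mulrAC divff ?mul1r ?expf_neq0 // mulrAC mulVf ?mul1r ?expf_neq0.
rewrite /GRing.comm /cas mulrBr mulrBl gY cas_shift -mulrA XY !mulrDr opprD.
by rewrite [- (Y * g) - _]addrC addrA addrK.
Qed.

Definition nf_mono (t : {poly K} * (nat * nat)) : A :=
  horner_alg C t.1 * H ^+ t.2.1 * X ^+ t.2.2.

Definition in_nf (u : A) := exists s, u = \sum_(t <- s) nf_mono t.

Lemma in_nf_mono t : in_nf (nf_mono t).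
Proof. by exists [:: t]; rewrite big_seq1. Qed.

Lemma in_nfD u v : in_nf u -> in_nf v -> in_nf (u + v).
Proof. by move=> [s ->] [t ->]; exists (s ++ t); rewrite big_cat. Qed.

Lemma in_nf0 : in_nf 0. Proof. by exists [::]; rewrite big_nil. Qed.

Lemma nf_monoZ c f jk : c *: nf_mono (f, jk) = nf_mono (c *: f, jk).
Proof. by rewrite /nf_mono linearZ /= -!scalerAl mul1r. Qed.

Lemma in_nf_lin (F : A -> A) : {morph F : u v / u + v} -> F 0 = 0 ->
  (forall t, in_nf (F (nf_mono t))) -> forall u, in_nf u -> in_nf (F u).
Proof.
move=> FD F0 Ft u [s ->]; elim: s => [|t s IHs].
  by rewrite big_nil F0; apply: in_nf0.
by rewrite big_cons FD; apply: in_nfD.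
Qed.

Lemma in_nfZ c u : in_nf u -> in_nf (c *: u).
Proof.
apply: in_nf_lin => [x y||[f jk]]; [exact: scalerDr | exact: scaler0|].
by rewrite nf_monoZ; apply: in_nf_mono.
Qed.

Lemma comm_horner u f : GRing.comm C u -> GRing.comm (horner_alg C f) u.
Proof.
move=> Cu; apply/commr_sym; rewrite /horner_alg /horner_morph horner_coef.
elim/big_rec: _ => [|i x _ ux]; first exact: commr0.
apply: commrD => //; apply: commrM; last exact/commrX/commr_sym.
by rewrite coef_map /=; rewrite /GRing.comm -scalerAl mul1r -scalerAr mulr1.
Qed.

Lemma in_nf_Hl u : in_nf u -> in_nf (H * u).
Proof.
apply: in_nf_lin => [x y||[f [j i]]]; [exact: mulrDr | exact: mulr0|].
have -> : H * nf_mono (f, (j, i)) = nf_mono (f, (j.+1, i)).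
  by rewrite /nf_mono /= !mulrA -(comm_horner f cas_commH) exprS !mulrA.
exact: in_nf_mono.
Qed.

Lemma in_nf_Xr u : in_nf u -> in_nf (u * X).
Proof.
apply: (in_nf_lin (F := *%R^~ X)) => [x y||[f [j i]]]; [exact: mulrDl | exact: mul0r|].
have -> : nf_mono (f, (j, i)) * X = nf_mono (f, (j, i.+1)).
  by rewrite /nf_mono /= exprSr !mulrA.
exact: in_nf_mono.
Qed.

Lemma in_nf_Xl u : in_nf u -> in_nf (X * u).
Proof.
apply: in_nf_lin => [x y||[f [j i]]]; [exact: mulrDr | exact: mulr0|].
have -> : X * nf_mono (f, (j, i)) = q ^+ j *: nf_mono (f, (j, i.+1)).
  rewrite /nf_mono /= !mulrA -(comm_horner f cas_commX) -[_ * X * _]mulrA.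
  by rewrite (q_commX j XH) -scalerAr -scalerAl exprS !mulrA.
exact/in_nfZ/in_nf_mono.
Qed.

(** Multiplication by Y leaves the span of the normal forms, but as YX = C + g(H)
    involves H^-2 at worst, one more factor X and two more factors H repair this. *)
Lemma in_nf_Y u : in_nf u -> in_nf (H ^+ 2 * (Y * u) * X).
Proof.
apply: (in_nf_lin (F := fun u => H ^+ 2 * (Y * u) * X)) => [x y||[f [j i]]].
- by rewrite !mulrDr mulrDl.
- by rewrite !mulr0 mul0r.
have YX : Y * X = C + g by rewrite /cas subrK.
have HC : H ^+ 2 * H ^+ j * C = C * H ^+ j.+2.
  by rewrite -exprD -(commrX _ cas_commH).
have Hg : H ^+ 2 * H ^+ j * g = (d * a) *: H ^+ j.+4 + - (d * b) *: H ^+ j.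
  rewrite -scalerAr mulrBr scalerBr scaleNr -!scalerAr !scalerA -exprD; congr (_ *: _ - _ *: _).
    by rewrite -exprD addnC.
  rewrite addnC exprD !expr2 -mulrA [X in _ * X](_ : _ = 1) ?mulr1 //.
  by rewrite -mulrA (mulrA H Hi) HHi mul1r HHi.
have -> : H ^+ 2 * (Y * nf_mono (f, (j, i))) * X = (q^-1) ^+ j *:
    (nf_mono (f * 'X, (j.+2, i)) + ((d * a) *: nf_mono (f, (j.+4, i))
                                   + - (d * b) *: nf_mono (f, (j, i)))).
  have -> : H ^+ 2 * (Y * nf_mono (f, (j, i))) * X =
      horner_alg C f * (H ^+ 2 * (Y * H ^+ j) * X) * X ^+ i.
    rewrite /nf_mono /= !mulrA -[_ * Y * _]mulrA -(comm_horner f cas_commY).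
    rewrite !mulrA -(commrX 2 (comm_horner f cas_commH)).
    by rewrite -!mulrA -exprS -exprSr.
  rewrite (q_commX j YH) -scalerAr -scalerAl -scalerAr -scalerAl; congr (_ *: _).
  rewrite [H ^+ 2 * _]mulrA -[_ * Y * X]mulrA YX [_ * (C + g)]mulrDr HC Hg.
  rewrite (mulrDr _ (C * _)) (mulrDr _ (_ *: _)) !(mulrDl _ _ (X ^+ i)) /nf_mono /=.
  congr (_ + (_ + _)).
  - by rewrite rmorphM /= horner_algX !mulrA.
  - by rewrite -scalerAr -scalerAl.
  - by rewrite -scalerAr -scalerAl.
apply: in_nfZ; apply: in_nfD; first exact: in_nf_mono.
by apply: in_nfD; apply: in_nfZ; apply: in_nf_mono.
Qed.

Hypothesis words_generate : forall T : A -> Prop,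
  T 1 -> (forall u v, T u -> T v -> T (u + v)) -> (forall c u, T u -> T (c *: u)) ->
  (forall u, T u -> [/\ T (X * u), T (Y * u), T (H * u) & T (Hi * u)]) ->
  forall u, T u.

Lemma in_nf_shift M N u : in_nf u -> in_nf (H ^+ M * u * X ^+ N).
Proof.
move=> nf_u; elim: N => [|N IHN].
  rewrite expr0 mulr1; elim: M => [|M IHM]; first by rewrite mul1r.
  by rewrite exprS -mulrA; apply: in_nf_Hl.
by rewrite exprSr mulrA; apply: in_nf_Xr.
Qed.

(** Stated for all large exponents, so that two elements can be given the same
    exponents. *)
Lemma nf_exists u : exists M N, forall M' N',
  (M <= M')%N -> (N <= N')%N -> in_nf (H ^+ M' * u * X ^+ N').
Proof.
suff [M [N nf_u]] : exists M N, in_nf (H ^+ M * u * X ^+ N).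
  exists M, N => M' N' /subnK <- /subnKC <-.
  by rewrite !exprD -!mulrA (mulrA u) (mulrA (H ^+ M)) !mulrA -(mulrA _ _ u)
     -(mulrA _ (_ * u)); apply: in_nf_shift.
elim/words_generate: u => [|u v [M1 [N1 nfu]] [M2 [N2 nfv]]|c u [M [N nfu]]|u [M [N nfu]]].
- exists 0%N, 0%N; rewrite !expr0 !mulr1.
  have -> : 1 = nf_mono (1, (0%N, 0%N)) by rewrite /nf_mono /= rmorph1 !mulr1.
  exact: in_nf_mono.
- exists (M2 + M1)%N, (N1 + N2)%N; rewrite mulrDr mulrDl; apply: in_nfD.
    rewrite !exprD -(mulrA _ _ u) !mulrA -(mulrA _ (H ^+ M1)) -(mulrA _ (_ * u)).
    exact: in_nf_shift.
  rewrite addnC (addnC N1) !exprD -(mulrA _ _ v) !mulrA -(mulrA _ (H ^+ M2)) -(mulrA _ (_ * v)).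
  exact: in_nf_shift.
- exists M, N; rewrite -scalerAr -scalerAl; exact: in_nfZ.
split.
- exists M, N.
  have -> : H ^+ M * (X * u) * X ^+ N = q ^- M *: (X * (H ^+ M * u * X ^+ N)).
    rewrite !mulrA (q_commX M XH) -!scalerAl scalerA mulVf ?scale1r //.
    by rewrite expf_neq0.
  by apply/in_nfZ/in_nf_Xl.
- exists M.+2, N.+1.
  have -> : H ^+ M.+2 * (Y * u) * X ^+ N.+1
      = q ^+ M *: (H ^+ 2 * (Y * (H ^+ M * u * X ^+ N)) * X).
    rewrite (mulrA Y) (mulrA Y) (q_commX M YH) -!scalerAl -scalerAr -scalerAl scalerA.
    rewrite exprVn divff ?expf_neq0 // scale1r -[M.+2]add2n exprD (exprSr X N).
    by rewrite !mulrA.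
  by apply/in_nfZ/in_nf_Y.
- exists M, N; rewrite mulrA -exprSr exprS -!mulrA; apply: in_nf_Hl.
  by rewrite mulrA.
- exists M.+1, N; rewrite mulrA exprSr -(mulrA (H ^+ M)) HHi mulr1; exact: nfu.
Qed.

(* co reads off the coordinates of an element of the quantum torus *)
Variables (L : nzRingType) (th : {rmorphism A -> L}) (k : fieldType).
Variables (ev : {rmorphism {poly K} -> k}) (sck : k -> L) (co : nat * nat -> L -> k).
Hypothesis ev_inj : injective ev.
Hypothesis co0 : forall e, co e 0 = 0.
Hypothesis coD : forall e u v, co e (u + v) = co e u + co e v.
Hypothesis coZ : forall e c u, co e (sck c * u) = c * co e u.
Hypothesis co_mono : forall e f e', co e (th (nf_mono (f, e'))) = if e' == e then ev f else 0.
Hypothesis sck_central : forall c u, sck c * u = u * sck c.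
Hypothesis X_regular : forall u N, u * X ^+ N = 0 -> u = 0.

(** The polynomials [p e] collect the terms of [u] with the same exponents [e]. *)
Lemma nf_coords u : in_nf u -> exists p : nat * nat -> {poly K},
  (forall e, co e (th u) = ev (p e)) /\ ((forall e, p e = 0) -> u = 0).
Proof.
move=> [s ->]; exists (fun e => \sum_(t <- s | t.2 == e) t.1); split=> [e|p0].
  elim: s => [|[f e'] s IHs]; first by rewrite !big_nil !rmorph0 co0.
  rewrite !big_cons rmorphD coD IHs co_mono /=.
  by case: eqP; rewrite ?rmorphD ?add0r.
have -> : \sum_(t <- s) nf_mono t
    = \sum_(e <- undup [seq t.2 | t <- s]) \sum_(t <- s | t.2 == e) nf_mono t.
  rewrite (exchange_big_dep predT) //= !big_seq; apply: eq_bigr => t ts.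
  rewrite -big_filter (eq_filter (a2 := pred1 t.2)) => [|e]; last exact: eq_sym.
  by rewrite filter_pred1_uniq ?undup_uniq ?mem_undup ?map_f // big_seq1.
rewrite big1 // => e _.
transitivity (nf_mono (\sum_(t <- s | t.2 == e) t.1, e)).
  rewrite /nf_mono /= raddf_sum !mulr_suml; apply: eq_bigr => t /eqP <- //.
by rewrite p0 /nf_mono rmorph0 !mul0r.
Qed.

Lemma H_regular M u : H ^+ M * u = 0 -> u = 0.
Proof.
elim: M u => [u|M IHM u]; first by rewrite mul1r.
rewrite exprSr -mulrA => /IHM Hu0.
by rewrite -[u]mul1r -HiH -mulrA Hu0 mulr0.
Qed.

Lemma nf_embedding_eq0 u : th u = 0 -> u = 0.
Proof.
move=> thu0; have [M [N nfu]] := nf_exists u.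
have [p [co_p p0]] := nf_coords (nfu M N (leqnn _) (leqnn _)).
apply/(@H_regular M)/(X_regular (N := N))/p0 => e.
by apply: ev_inj; rewrite -co_p !rmorphM thu0 mulr0 mul0r co0 rmorph0.
Qed.

(** Choose exponents for which both elements become combinations of normal
    forms; their coordinates are proportional with ratio [c], and some coordinate of [v]
    is nonzero. *)
Lemma nf_embedding_ratio u v c : v <> 0 -> th u = sck c * th v ->
  exists f g, ev g != 0 /\ ev f = c * ev g.
Proof.
move=> nzv uv; have [M1 [N1 nfu]] := nf_exists u; have [M2 [N2 nfv]] := nf_exists v.
pose M := maxn M1 M2; pose N := maxn N1 N2.
have [p [co_p _]] := nf_coords (nfu M N (leq_maxl _ _) (leq_maxl _ _)).
have [r [co_r r0]] := nf_coords (nfv M N (leq_maxr _ _) (leq_maxr _ _)).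
have [e /eqP re] : exists e, r e <> 0.
  apply: contrapT => /forallNP r_eq0; apply/nzv/(@H_regular M)/(X_regular (N := N))/r0.
  by move=> e; apply: contrapT (r_eq0 e).
exists (p e), (r e); split.
  by rewrite -(rmorph0 ev); apply: contra_neq re => /ev_inj.
rewrite -co_p -co_r -coZ; congr co; rewrite !rmorphM uv.
by rewrite !mulrA -sck_central.
Qed.

End NormalForms.

(** * Extension to the division ring of fractions *)

Section FractionExtension.
Variables (K : fieldType) (A : algType K) (Q : unitAlgType K) (j : {lrmorphism A -> Q}).
Hypotheses (j_inj : injective j) (unitQ : forall x : Q, x != 0 -> x \is a GRing.unit).
Hypothesis fracQ : forall x : Q, exists a b, b != 0 /\ x = j a / j b.
Variables (L : nzRingType) (th : {rmorphism A -> L}).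
Hypotheses (divL : division_ring L) (th_inj : injective th).
Implicit Types (a b c d e f w : A) (x y : Q) (l m : L).

Lemma frac_unit a : a != 0 -> j a \is a GRing.unit.
Proof. by move=> a0; apply: unitQ; rewrite -(raddf0 j) (inj_eq j_inj). Qed.

Lemma frac_th_neq0 a : a != 0 -> th a != 0.
Proof. by move=> a0; rewrite -(raddf0 th) (inj_eq th_inj). Qed.

Lemma frac_mul_neq0 a b : a != 0 -> b != 0 -> a * b != 0.
Proof.
move=> /frac_unit ua /frac_unit ub; apply/eqP => /(congr1 j).
rewrite rmorphM raddf0 => jab0.
have : j a * j b \is a GRing.unit by rewrite unitrMl.
by rewrite jab0 unitr0.
Qed.

(** Writing the left fraction of [c] by [b] as a right fraction is the Ore
    condition. *)
Lemma frac_ore b c : b != 0 -> exists e f, f != 0 /\ b * e = c * f.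
Proof.
move=> b0; have [e [f [f0 ef]]] := fracQ ((j b)^-1 * j c).
exists e, f; split=> //; apply: j_inj; rewrite !rmorphM.
by apply: (mulrI (_ : (j b)^-1 \is a GRing.unit)); rewrite ?unitrV ?frac_unit // mulKr ?mulrA
   ?ef ?divrK ?frac_unit.
Qed.

(** [frac_rel x l]: the value at [x] of an extension of [th] has to be [l]. *)
Definition frac_rel (x : Q) (l : L) :=
  exists a b, [/\ b != 0, x * j b = j a & l * th b = th a].

Lemma frac_relP x : exists l, frac_rel x l.
Proof.
have [a [b [b0 ->]]] := fracQ x.
have [v bv vb] := division_ringV divL (frac_th_neq0 b0).
by exists (th a * v), a, b; rewrite divrK ?frac_unit // -mulrA vb mulr1.
Qed.

Lemma frac_rel_common x y l m : frac_rel x l -> frac_rel y m ->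
  exists a c w, [/\ w != 0, x * j w = j a /\ l * th w = th a
                         & y * j w = j c /\ m * th w = th c].
Proof.
move=> [a [b [b0 xb lb]]] [c [d [d0 yd md]]].
have [e [f [f0 bedf]]] := frac_ore d b0.
exists (a * e), (c * f), (b * e); split.
- by rewrite bedf frac_mul_neq0.
- by rewrite !rmorphM !mulrA xb lb.
by rewrite bedf !rmorphM !mulrA yd md.
Qed.

Lemma frac_rel_fun x l m : frac_rel x l -> frac_rel x m -> l = m.
Proof.
move=> xl xm; have [a [c [w [w0 [xa la] [xc mc]]]]] := frac_rel_common xl xm.
have ac : a = c by apply: j_inj; rewrite -xa -xc.
have [v wv _] := division_ringV divL (frac_th_neq0 w0).
by rewrite -[l]mulr1 -[m]mulr1 -wv !mulrA la mc ac.
Qed.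

Lemma frac_relB x y l m : frac_rel x l -> frac_rel y m -> frac_rel (x - y) (l - m).
Proof.
move=> xl ym; have [a [c [w [w0 [xa la] [yc mc]]]]] := frac_rel_common xl ym.
by exists (a - c), w; rewrite !mulrBl xa la yc mc !rmorphB.
Qed.

Lemma frac_relM x y l m : frac_rel x l -> frac_rel y m -> frac_rel (x * y) (l * m).
Proof.
move=> [a [b [b0 xb lb]]] [c [d [d0 yd md]]].
have [e [f [f0 becf]]] := frac_ore c b0.
exists (a * e), (d * f); split; first exact: frac_mul_neq0.
- by rewrite !rmorphM -!mulrA (mulrA y) yd -(rmorphM j c f) -becf !rmorphM mulrA xb.
- by rewrite !rmorphM -!mulrA (mulrA m) md -(rmorphM th c f) -becf !rmorphM mulrA lb.
Qed.

Lemma frac_rel_j a : frac_rel (j a) (th a).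
Proof. by exists a, 1; rewrite oner_neq0 !rmorph1 !mulr1. Qed.

Lemma fraction_extension : exists Th : {rmorphism Q -> L}, forall a, Th (j a) = th a.
Proof.
pose F x := projT1 (cid (frac_relP x)).
have FP x : frac_rel x (F x) by rewrite /F; case: cid.
have FB : zmod_morphism F.
  by move=> x y; apply: frac_rel_fun (FP _) _; apply: frac_relB.
have F1 : monoid_morphism F.
  split=> [|x y]; first by apply: frac_rel_fun (FP _) _; have := frac_rel_j 1; rewrite !rmorph1.
  by apply: frac_rel_fun (FP _) _; apply: frac_relM.
pose FM := GRing.isMonoidMorphism.Build Q L F F1.
pose FZ := GRing.isZmodMorphism.Build Q L F FB.
pose Th : {rmorphism Q -> L} := HB.pack F FZ FM.
exists Th => a; exact: frac_rel_fun (FP _) (frac_rel_j a).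
Qed.

End FractionExtension.

Local Open Scope classical_set_scope.

(** * Subalgebras of a division ring whose scalars are not commutators *)

Section EmbeddedAlgebra.
Variables (K Kb : fieldType) (iota : {rmorphism K -> Kb}) (A : algType K).
Variables (L : nzRingType) (scal : {rmorphism Kb -> L}) (phi : {rmorphism A -> L}).
Hypothesis scal_central : forall c u, scal c * u = u * scal c.
Hypothesis phi_inj : injective phi.
Hypothesis phiZ : forall c a, phi (c *: a) = scal (iota c) * phi a.

Definition tens_eval (s : seq (Kb * A)) : L := \sum_(t <- s) scal t.1 * phi t.2.

Lemma tens_eval_cat s t : tens_eval (s ++ t) = tens_eval s + tens_eval t.
Proof. exact: big_cat. Qed.

Lemma tens_eval1 l a : tens_eval [:: (l, a)] = scal l * phi a.
Proof. exact: big_seq1. Qed.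

Lemma tens_eval_eq s t : tens_eq iota s t -> tens_eval s = tens_eval t.
Proof.
elim=> {s t}.
- by [].
- by move=> s t _ ->.
- by move=> s t u _ -> _ ->.
- by move=> s s' t t' _ es _ et; rewrite !tens_eval_cat es et.
- by move=> s t; rewrite !tens_eval_cat addrC.
- by move=> a; rewrite tens_eval1 rmorph0 mul0r /tens_eval big_nil.
- by move=> l l' a; rewrite (tens_eval_cat [:: _] [:: _]) !tens_eval1 rmorphD mulrDl.
- by move=> l a a'; rewrite (tens_eval_cat [:: _] [:: _]) !tens_eval1 rmorphD mulrDr.
- by move=> c l a; rewrite !tens_eval1 phiZ rmorphM mulrA.
Qed.

(** The map sending l (x) a to l times the image of a. It is a ring morphism
    because scalars are central. *)
Definition bc_eval (x : base_change iota A) : L := tens_eval (repr x).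

Lemma bc_eval_tens s : bc_eval (tens iota s) = tens_eval s.
Proof. exact/tens_eval_eq/tens_repr. Qed.

Lemma bc_evalD x y : bc_eval (x + y) = bc_eval x + bc_eval y.
Proof.
rewrite -[x]tens_reprK -[y]tens_reprK -tens_add.
by rewrite !bc_eval_tens tens_eval_cat.
Qed.

Lemma bc_eval0 : bc_eval 0 = 0.
Proof. by rewrite -[0]/(tens iota [::]) bc_eval_tens /tens_eval big_nil. Qed.

Lemma bc_evalZ l x : bc_eval (l *: x) = scal l * bc_eval x.
Proof.
rewrite -[x]tens_reprK [_ *: _]bc_scaleE !bc_eval_tens /tens_eval big_map mulr_sumr.
by apply: eq_bigr => t _; rewrite rmorphM mulrA.
Qed.

Lemma bc_evalM x y : bc_eval (x * y) = bc_eval x * bc_eval y.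
Proof.
rewrite -[x]tens_reprK -[y]tens_reprK [_ * _ in LHS]bc_mulE !bc_eval_tens /tens_eval.
rewrite big_allpairs_dep /= mulr_suml; apply: eq_bigr => t _.
rewrite mulr_sumr; apply: eq_bigr => u _.
by rewrite !rmorphM -!mulrA; congr (_ * _); rewrite !mulrA -scal_central.
Qed.

Lemma bc_evalB x y : bc_eval (x - y) = bc_eval x - bc_eval y.
Proof. by apply/eqP; rewrite eq_sym subr_eq -bc_evalD subrK. Qed.

Lemma bc_eval_pure l a : bc_eval (pure iota l a) = scal l * phi a.
Proof. by rewrite bc_eval_tens tens_eval1. Qed.

Hypothesis divL : division_ring L.
Hypothesis no_scalar_commutator : forall u v c, u * v - v * u = scal c -> c = 0.

(** With [w] the inverse of [v], the scalar [c] is the commutator of [w] and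
    [v * u]. *)
Lemma no_eigenvector (u v : L) (c : Kb) : c <> 0 -> u * v - v * u = scal c * v -> v = 0.
Proof.
move=> c0 uv; apply/eqP/negP => /negP/(division_ringV divL)[w vw wv]; apply: c0.
apply: (no_scalar_commutator (u := w) (v := v * u)).
have -> : w * (v * u) = u * v * w by rewrite mulrA wv mul1r -mulrA vw mulr1.
by rewrite -mulrBl uv -mulrA vw mulr1.
Qed.

(** If [w] were invertible, with inverse [z], then [z] would commute with [u] and the
    commutator of [u] and [v * z] would be 1. *)
Lemma no_nilpotent (u v : L) : let w := u * v - v * u in u * w - w * u = 0 -> w = 0.
Proof.
move=> w; move/eqP; rewrite subr_eq0 => /eqP uw; apply/eqP/negP => /negP/(division_ringV divL)[z wz zw].
have uz : u * z = z * u.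
  by rewrite -[u * z]mul1r -zw -mulrA (mulrA w u) -uw -!mulrA wz mulr1.
have /no_scalar_commutator/eqP : u * (v * z) - v * z * u = scal 1.
  by rewrite rmorph1 -mulrA -uz !mulrA -mulrBl -/w.
by apply/negP/oner_neq0.
Qed.

Lemma phi_ad (a b : A) : phi (ad a b) = phi a * phi b - phi b * phi a.
Proof. by rewrite rmorphB !rmorphM. Qed.

Lemma nil_setE (a : A) : nil_set a = centralizer a.
Proof.
apply/seteqP; split=> b; last by exists 0%N.
case; elim=> [//|i IHi] /= adi; apply: IHi; rewrite /=.
apply: phi_inj; rewrite rmorph0 phi_ad; apply: no_nilpotent.
by rewrite -!phi_ad -(raddf0 phi) -adi.
Qed.

(** Only the eigenvectors of eigenvalue 0 can have a nonzero image under
    [bc_eval], so the image of [b] commutes with that of [a]. The image of the base change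
    is enough, as [phi] is injective on the algebra itself. *)
Lemma diag_setE (a : A) : diag_set iota a = centralizer a.
Proof.
apply/seteqP; split=> b.
  move=> [n [l [v [av bv]]]]; apply: phi_inj; rewrite rmorph0 phi_ad.
  have phib : phi b = \sum_(i < n) bc_eval (v i).
    have <- : bc_eval (pure iota 1 b) = phi b by rewrite bc_eval_pure rmorph1 mul1r.
    by rewrite bv (big_morph _ bc_evalD bc_eval0).
  rewrite phib mulr_suml mulr_sumr -sumrB big1 // => i _.
  have := congr1 bc_eval (av i).
  rewrite bc_evalB !bc_evalM bc_eval_pure rmorph1 mul1r bc_evalZ => avi.
  have [li0|/eqP li0] := eqVneq (l i) 0; first by rewrite avi li0 rmorph0 mul0r.
  by rewrite (no_eigenvector li0 avi) mulr0 mul0r subrr.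
move=> ab; exists 1%N, (fun=> 0), (fun=> pure iota 1 b); split; last by rewrite big_ord1.
move=> _; rewrite scale0r.
have mulP a1 a2 : pure iota 1 a1 * pure iota 1 a2 = pure iota 1 (a1 * a2).
  by rewrite [LHS]bc_mulE /seq_mul /= mulr1.
have /eqP := ab; rewrite subr_eq0 => /eqP ab'.
by rewrite /ad !mulP ab' subrr.
Qed.

Lemma all_generic (a : A) : ~ center A a -> generic iota a.
Proof. by move=> za; split=> //; [apply: nil_setE | apply: diag_setE]. Qed.

Hypothesis centralizer_central_or_comm : forall f : L, (forall g, f * g = g * f) \/
  (forall u v, GRing.comm f u -> GRing.comm f v -> GRing.comm u v).
Hypothesis A_noncomm : noncommutative A.

Lemma embedded_commutative_centralizer : commutative_centralizer_condition A.
Proof.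
split=> // a za b c ab ac; apply: phi_inj; rewrite !rmorphM.
have [phia|] := centralizer_central_or_comm (phi a).
  by case: za => d; apply: phi_inj; rewrite !rmorphM.
have comm_phi d : centralizer a d -> GRing.comm (phi a) (phi d).
  by move=> /eqP; rewrite subr_eq0 => /eqP ad; rewrite /GRing.comm -!rmorphM ad.
by apply; apply: comm_phi.
Qed.

Lemma embedded_dixmier : dixmier_partition iota A.
Proof.
apply/seteqP; split=> a; first by move=> za; right; apply: all_generic.
by case=> [[[[|]|]|]|] [].
Qed.

(** A noncentral element is not both generic and of another type: a generic
    element has N(a) = D(a) = C(a), and C(a) is not the whole algebra. *)
Lemma embedded_homogeneous : homogeneous_centralizer_condition iota A.
Proof.
split=> //; first exact: embedded_dixmier.
move=> a za; have gen : centralizer a `\` center A `<=` generic iota (A := A).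
  by move=> b [_ zb]; apply: all_generic.
have aE : (centralizer a `\` center A) a by split=> //; rewrite /centralizer /= /ad subrr.
have not_all : centralizer a <> setT.
  move=> /seteqP[_ aT]; apply: za => b; have /eqP := aT b I.
  by rewrite subr_eq0 => /eqP.
exists ord_max; split=> // i; case: i => [[|[|[|[|[|//]]]]] lt_i]; rewrite /centralizer_kind /=.
- by move=> /(_ a aE)[_ + _]; rewrite nil_setE.
- by move=> /(_ a aE)[_ + _ _]; rewrite nil_setE.
- move=> [b [zb nb db] _].
  have : centralizer b <> setT.
    move=> /seteqP[_ bT]; apply: zb => c; have /eqP := bT c I.
    by rewrite subr_eq0 => /eqP.
  by rewrite -diag_setE db.
- by move=> [b [_ _ + _ _] _]; rewrite diag_setE.
- by move=> _; apply: val_inj.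
Qed.

End EmbeddedAlgebra.

(** * The theorem, from an embedding in a division ring *)

Section ThroughTheEmbedding.
Variables (K Kb : fieldType) (iota : {rmorphism K -> Kb}) (q : K).
Variables (U : algType K) (X Y H Hi : U) (Q : unitAlgType K) (j : {lrmorphism U -> Q}).
Hypotheses (q_neq0 : q != 0) (q1 : q != 1) (q2 : q ^+ 2 != 1).
Hypothesis frac_j : is_division_ring_of_fractions j.
Variables (k : fieldType) (e : {rmorphism Kb -> k}) (ev : {rmorphism {poly K} -> k}).
Hypotheses (evC : forall a, ev a%:P = e (iota a)) (ev_inj : injective ev).
Variables (L : nzRingType) (sck : {rmorphism k -> L}) (x y h hi : L).
Variable co : nat * nat -> L -> k.
Hypothesis divL : division_ring L.
Hypothesis sck_central : forall d u, sck d * u = u * sck d.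
Hypothesis co0 : forall i, co i 0 = 0.
Hypothesis coD : forall i u v, co i (u + v) = co i u + co i v.
Hypothesis coZ : forall i d u, co i (sck d * u) = d * co i u.
Hypothesis co_mono : forall i d i',
  co i (sck d * h ^+ i'.1 * x ^+ i'.2) = if i' == i then d else 0.
Hypothesis no_scalar_commutator : forall u v d, u * v - v * u = sck d -> d = 0.
Hypothesis centralizer_alt : forall f, (exists d, f = sck d) \/
  (forall u v, GRing.comm f u -> GRing.comm f v -> GRing.comm u v).
Local Notation sc a := (sck (e (iota a))).
Local Notation qd := (q - q^-1)^-1.
Local Notation qa := (q ^+ 2 - 1)^-1.
Local Notation qb := (q ^- 2 - 1)^-1.
Hypotheses (XH : X * H = q *: (H * X)) (YH : Y * H = q^-1 *: (H * Y))
  (XY : X * Y = Y * X + qd *: (H ^+ 2 - Hi ^+ 2)) (HHi : H * Hi = 1) (HiH : Hi * H = 1).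
Hypothesis words_generate : forall T : U -> Prop,
  T 1 -> (forall u v, T u -> T v -> T (u + v)) -> (forall c u, T u -> T (c *: u)) ->
  (forall u, T u -> [/\ T (X * u), T (Y * u), T (H * u) & T (Hi * u)]) ->
  forall u, T u.
Local Notation C := (cas qd qa qb X Y H Hi).
Variable th : {rmorphism U -> L}.
Hypotheses (thZ : forall a u, th (a *: u) = sc a * th u)
  (thX : th X = x) (thY : th Y = y) (thH : th H = h) (thHi : th Hi = hi).
Hypothesis yxE : y * x - sc qd * (sc qa * h ^+ 2 - sc qb * hi ^+ 2) = sck (ev 'X).

Section Horner.
Variables (A : algType K) (phi : {rmorphism A -> L}) (cA : A).
Hypotheses (phiZ : forall a u, phi (a *: u) = sc a * phi u) (phi_c : phi cA = sck (ev 'X)).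

Lemma embed_horner f : phi (horner_alg cA f) = sck (ev f).
Proof.
elim/poly_ind: f => [|f a IHf]; first by rewrite !rmorph0.
rewrite !rmorphD !rmorphM /= IHf horner_algX phi_c; congr (_ + _).
by rewrite horner_algC phiZ rmorph1 mulr1 evC.
Qed.

End Horner.

Lemma sck_neq0 d : d != 0 -> sck d <> 0.
Proof.
move=> d0 sd; have := rmorph1 sck; rewrite -(mulVf d0) rmorphM sd mulr0 => /eqP.
by rewrite eq_sym oner_eq0.
Qed.

Lemma xh_neq : x * h <> h * x.
Proof.
have xh : x * h = sc q * (h * x) by rewrite -thX -thH -!rmorphM XH thZ.
move=> xh_eq; have := co_mono (1, 1)%N (e (iota q) - 1) (1, 1)%N; rewrite eqxx !expr1.
rewrite rmorphB rmorph1 mulrBl mul1r mulrBl -mulrA -xh xh_eq subrr co0 => /esym/eqP.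
by rewrite subr_eq0 fmorph_eq1 fmorph_eq1 (negPf q1).
Qed.

Let scal : {rmorphism Kb -> L} := sck \o e.

Lemma embed_casimir : th C = sck (ev 'X).
Proof.
by rewrite -yxE /cas rmorphB rmorphM thX thY thZ rmorphB !thZ !rmorphXn thH thHi.
Qed.

Lemma embed_nf i f i' : co i (th (nf_mono qd qa qb X Y H Hi (f, i')))
  = if i' == i then ev f else 0.
Proof.
rewrite /nf_mono !rmorphM !rmorphXn thX thH /=.
by rewrite (embed_horner (phi := th) thZ embed_casimir) co_mono.
Qed.

(** Although the absence of zero divisors is not known beforehand, X is regular
    because it is sent to a unit of the division ring of fractions. *)
Lemma frac_X_regular u N : u * X ^+ N = 0 -> u = 0.
Proof.
have [j_inj unitQ fracQ _] := frac_j.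
have jX : j X \is a GRing.unit.
  apply: unitQ; rewrite -(raddf0 j) (inj_eq j_inj); apply/eqP => X0.
  by apply: xh_neq; rewrite -thX X0 rmorph0 mul0r mulr0.
move=> /(congr1 j); rewrite rmorphM rmorphXn raddf0 => uX0.
apply: j_inj; rewrite raddf0.
by rewrite -(mulrK (unitrX N jX) (j u)) uX0 mul0r.
Qed.

Lemma qaE : q ^+ 2 * qa - qa = 1.
Proof. by rewrite -[X in _ - X]mul1r -mulrBl divff // subr_eq0. Qed.

Lemma qbE : q ^- 2 * qb - qb = 1.
Proof. by rewrite -[X in _ - X]mul1r -mulrBl divff // subr_eq0 invr_eq1. Qed.

Lemma embed_inj : injective th.
Proof.
move=> u v uv; apply/eqP; rewrite -subr_eq0; apply/eqP.
apply: (nf_embedding_eq0 q_neq0 XH YH XY HHi HiH qaE qbE words_generate ev_inj co0 coD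
  embed_nf frac_X_regular).
by rewrite rmorphB uv subrr.
Qed.

Lemma embed_ratio u v d : v <> 0 -> th u = sck d * th v ->
  exists f g, ev g != 0 /\ ev f = d * ev g.
Proof.
exact: (nf_embedding_ratio q_neq0 XH YH XY HHi HiH qaE qbE words_generate ev_inj co0 coD
  coZ embed_nf sck_central frac_X_regular).
Qed.

Lemma central_or_commutative (f : L) : (forall g, f * g = g * f) \/
  (forall u v, GRing.comm f u -> GRing.comm f v -> GRing.comm u v).
Proof.
have [[d ->]|] := centralizer_alt f; last by right.
by left=> g; apply: sck_central.
Qed.

(** A central element of [Q] commutes with X and H, so its centralizer is not
    commutative and its image is a constant of [k]; [embed_ratio] then recovers it as
    a fraction in the Casimir element. Conversely such fractions have central images. *)
Theorem structure_via_embedding :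
  [/\ commutative_centralizer_condition U,
      commutative_centralizer_condition Q
    & center Q = rational_in (j C)]
  /\
  ([/\ dixmier_partition iota U,
       homogeneous_centralizer_condition iota U
     & commutative_centralizer_condition U]
   /\
   (forall S : subalgClosed Q,
      noncommutative (subalgebra S) ->
      [/\ dixmier_partition iota (subalgebra S),
          homogeneous_centralizer_condition iota (subalgebra S)
        & commutative_centralizer_condition (subalgebra S)])).
Proof.
have th_inj := embed_inj; have thC := embed_casimir.
have [j_inj unitQ fracQ _] := frac_j.
have [Th Thj] := fraction_extension j_inj unitQ fracQ divL th_inj.
have ThZ a u : Th (a *: u) = sc a * Th u.
  have -> : a *: u = j a%:A * u by rewrite linearZ rmorph1 -scalerAl mul1r.
  by rewrite rmorphM Thj thZ rmorph1 mulr1.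
have Th_inj : injective Th.
  move=> u v uv; apply/eqP; rewrite -subr_eq0; apply/negPn/negP => /unitQ w_unit.
  have := rmorph1 Th; rewrite -(divrr w_unit) rmorphM rmorphB uv subrr mul0r => /eqP.
  by rewrite eq_sym oner_eq0.
have scal_central c u : scal c * u = u * scal c by exact: sck_central.
have nsc u v c : u * v - v * u = scal c -> c = 0.
  by move=> /no_scalar_commutator/eqP; rewrite fmorph_eq0 => /eqP.
have U_nc : noncommutative U.
  exists X, H => /(congr1 th); rewrite !rmorphM thX thH.
  exact: xh_neq.
have Q_nc : noncommutative Q.
  have [a [b ab]] := U_nc; exists (j a), (j b); rewrite -!rmorphM => /j_inj.
  exact: ab.
have U_cc := embedded_commutative_centralizer th_inj central_or_commutative U_nc.
have Q_cc := embedded_commutative_centralizer Th_inj central_or_commutative Q_nc.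
split; last split.
- split=> //; apply/seteqP; split=> z.
    move=> zc.
    have Thz_comm u : GRing.comm (Th z) (Th u) by rewrite /GRing.comm -!rmorphM zc.
    have [[d zd]|] := centralizer_alt (Th z); last first.
      move=> /(_ (Th (j X)) (Th (j H)) (Thz_comm _) (Thz_comm _)).
      by rewrite !Thj thX thH => /xh_neq.
    have [a [b [b0 zab]]] := fracQ z.
    have jb : j b \is a GRing.unit by apply: unitQ; rewrite -(raddf0 j) (inj_eq j_inj).
    have ab : th a = sck d * th b by rewrite -!Thj -zd -rmorphM zab divrK.
    have [f [g [g0 fg]]] := embed_ratio (elimN eqP b0) ab.
    have Thh := embed_horner ThZ (etrans (Thj _) thC).
    have g_neq0 : horner_alg (j C) g != 0.
      by apply/eqP => /(congr1 Th); rewrite Thh rmorph0; apply: sck_neq0.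
    exists f, g; split=> //; apply: (mulIr (unitQ _ g_neq0)); rewrite divrK ?unitQ //.
    by apply: Th_inj; rewrite rmorphM !Thh zd -rmorphM fg.
  move=> [f [g [g0 ->]]] b; apply: (Th_inj); rewrite !rmorphM.
  have Thh := embed_horner ThZ (etrans (Thj _) thC).
  have evg : ev g != 0.
    by apply: contra_neq g0 => evg; apply: Th_inj; rewrite Thh evg !rmorph0.
  have -> : Th (horner_alg (j C) g)^-1 = sck (ev g)^-1.
    rewrite -[LHS]mulr1 -(rmorph1 sck) -(divff evg) rmorphM mulrA -Thh -rmorphM.
    by rewrite mulVr ?unitQ // rmorph1 mul1r.
  by rewrite Thh -rmorphM sck_central.
- split=> //; first exact: (embedded_dixmier scal_central th_inj thZ divL nsc).
  exact: (embedded_homogeneous scal_central th_inj thZ divL nsc).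
move=> S S_nc.
pose phi : {rmorphism subalgebra S -> L} := Th \o val.
have phi_inj : injective phi by move=> a b /Th_inj/val_inj.
have phiZ a u : phi (a *: u) = sc a * phi u by rewrite /phi /= -ThZ.
split.
- exact: (embedded_dixmier scal_central phi_inj phiZ divL nsc).
- exact: (embedded_homogeneous scal_central phi_inj phiZ divL nsc).
- exact: (embedded_commutative_centralizer phi_inj central_or_commutative S_nc).
Qed.

End ThroughTheEmbedding.

(** * The quantum algebra U_q sl(2) *)

Theorem proposition6p2 (R : realType) (K : fieldType)
  (Kbar : closedFieldType) (iota : {rmorphism K -> Kbar}) (q : K)
  (Q : unitAlgType K) (j : {lrmorphism Uqsl2 q -> Q}) :
  (* K has characteristic zero and iota makes Kbar an algebraic closure of K *)
  [pchar K] =i pred0 ->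
  (forall x : Kbar, algebraicOver iota x) ->
  q != 0 ->
  (forall n : nat, (0 < n)%N -> q ^+ n != 1) ->
  is_division_ring_of_fractions j ->
  [/\ commutative_centralizer_condition (Uqsl2 q),
      commutative_centralizer_condition Q
    & center Q = rational_in (j (casimir q))]
  /\
  ([/\ dixmier_partition iota (Uqsl2 q),
       homogeneous_centralizer_condition iota (Uqsl2 q)
     & commutative_centralizer_condition (Uqsl2 q)]
   /\
   (forall S : subalgClosed Q,
      noncommutative (subalgebra S) ->
      (GKdim R (subalgebra S) < 4%:E)%E ->
      [set x | x \in S] `&` rational_in (j (casimir q)) <> scalars Q ->
      [/\ dixmier_partition iota (subalgebra S),
          homogeneous_centralizer_condition iota (subalgebra S)
        & commutative_centralizer_condition (subalgebra S)])).
Proof.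
move=> _ _ q_neq0 q_nroot frac_j.
pose k : fieldType := {fraction {poly Kbar}}.
pose e : {rmorphism Kbar -> k} := @tofrac _ \o polyC.
pose ev : {rmorphism {poly K} -> k} := @tofrac _ \o map_poly iota.
pose s : k := e (iota q).
have s_neq0 : s != 0 by rewrite !fmorph_eq0.
have s_nroot n : (0 < n)%N -> s ^+ n != 1.
  by move=> n_gt0; rewrite -!rmorphXn !fmorph_eq1; apply: q_nroot.
pose c : k := ev 'X.
pose L := laurent (dilation_twist s_neq0).
pose sck : {rmorphism k -> L} := const _ \o const _.
have sck_central d u : sck d * u = u * sck d by apply: scal_central.
have evC a : ev a%:P = e (iota a) by rewrite /ev /= map_polyC.
have ev_inj : injective ev.
  by move=> f g /eqP; rewrite /= tofrac_eq => /eqP/map_poly_inj.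
have dE : e (iota (q - q^-1)^-1) = (s - s^-1)^-1 by rewrite !fmorphV !rmorphB !fmorphV.
have aE : e (iota (q ^+ 2 - 1)^-1) = (s ^+ 2 - 1)^-1.
  by rewrite !fmorphV !rmorphB !rmorphXn !rmorph1.
have bE : e (iota (q ^- 2 - 1)^-1) = (s ^- 2 - 1)^-1.
  by rewrite !fmorphV !rmorphB !fmorphV !rmorphXn !rmorph1.
have VE : e (iota q^-1) = s^-1 by rewrite !fmorphV.
have s2 : s ^+ 2 != 1 by apply: s_nroot.
have [th [thZ thX thY thH thHi]] := @uq_universal K q L (sck \o e \o iota)
  (qt_x s_neq0) (qt_y c s_neq0) (qt_h s_neq0) (qt_hi s_neq0)
  (fun a u => sck_central _ u) (qt_xh s_neq0)
  (etrans (qt_yh c s_neq0) (congr1 (fun d => sck d * _) (esym VE)))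
  (etrans (qt_commutator c s_neq0 s2) (congr1 (fun d => sck d * _) (esym dE)))
  (qt_hhi s_neq0) (qt_hih s_neq0).
have [XH YH XY HHi HiH] := uq_relations_hold q.
have yxE : qt_y c s_neq0 * qt_x s_neq0
    - sck (e (iota (q - q^-1)^-1)) * (sck (e (iota (q ^+ 2 - 1)^-1)) * qt_h s_neq0 ^+ 2
       - sck (e (iota (q ^- 2 - 1)^-1)) * qt_hi s_neq0 ^+ 2) = sck (ev 'X).
  by rewrite dE aE bE; apply: qt_casimir.
have q1 : q != 1 := q_nroot 1 isT.
have q2 : q ^+ 2 != 1 := q_nroot 2 isT.
have [part1 [part2 part3]] := @structure_via_embedding K Kbar iota q (Uqsl2 q) (uqX q)
  (uqY q) (uqH q) (uqHi q) Q j q_neq0 q1 q2 frac_j k e ev evC ev_inj L sck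
  (qt_x s_neq0) (qt_y c s_neq0) (qt_h s_neq0) (qt_hi s_neq0) (@qt_coord k s s_neq0)
  (@qt_division k s s_neq0) sck_central (@qt_coord0 k s s_neq0) (@qt_coordD k s s_neq0)
  (@qt_coordZ k s s_neq0) (@qt_coord_monomial k s s_neq0)
  (@qt_no_scalar_commutator k s s_neq0) (@qt_centralizer k s s_neq0 s_nroot)
  XH YH XY HHi HiH (@uq_ind K q) th thZ thX thY thH thHi yxE.
split; first exact: part1.
split; first exact: part2.
by move=> S S_nc _ _; apply: part3.
Qed.
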